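(* Let $\Lambda\subset\mathbb{Z}$ be a nonempty finite centrally symmetric set ($\Lambda=-\Lambda$), and let $f_\Lambda$ be a random real Laurent polynomial with spectrum $\Lambda$. Then: (a) The expected number of real roots of $f_\Lambda$ equals $$2\sqrt{\frac{1}{\#\Lambda}\sum_{\lambda\in\Lambda}\lambda^2}.$$ (b) If $\Lambda\neq\{0\}$, the probability $\mathcal P(\Lambda)$ that a root of $f_\Lambda$ is real is $$\mathcal P(\Lambda)=\frac{1}{\deg(f_\Lambda)}\sqrt{\frac{1}{\#\Lambda}\sum_{\lambda\in\Lambda}\lambda^2},\qquad \deg(f_\Lambda)=\max_{\lambda\in\Lambda}|\lambda|.$$
   Context: A Laurent polynomial with spectrum $\Lambda$ is a function $P(z)=\sum_{m\in\Lambda}a_mz^m$ on $\mathbb{C}\setminus\{0\}$. It is called real if its restriction to the unit circle $S\subset\mathbb{C}$ is real-valued (equivalently $a_k=\overline{a_{-k}}$ for all $k$). A real root is a root lying on $S$. Restriction to $S$ identifies the space of real Laurent polynomials with spectrum $\Lambda$ with the real vector space ${\rm Trig}(\Lambda)$ of functions $\sum_{k\in\Lambda}(\alpha_k\cos(k\theta)+\beta_k\sin(k\theta))$, $\alpha_k,\beta_k\in\mathbb{R}$ (of dimension $\#\Lambda$), equipped with the inner product $(f,g)=\int_S f(\theta)g(\theta)\,d\theta$. A random real Laurent polynomial with spectrum $\Lambda$ is a random element of ${\rm Trig}(\Lambda)$ distributed according to the standard (centered) Gaussian measure of this Euclidean space. The probability $\mathcal P(\Lambda)$ that a root is real is the expectation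 of the ratio (number of real roots of $f_\Lambda$)/(number of roots of $f_\Lambda$ in $\mathbb{C}\setminus\{0\}$, counted with multiplicity); the denominator is almost surely equal to the constant $2\max_{\lambda\in\Lambda}|\lambda|$. *)

(* Defs.v *)
From HB Require Import structures.
From mathcomp Require Import all_boot all_order all_algebra finmap.
From mathcomp Require Import all_classical all_reals all_analysis.
From mathcomp Require Import complex.

Set Implicit Arguments.
Unset Strict Implicit.
Unset Printing Implicit Defensive.

Import Order.TTheory GRing.Theory Num.Theory.
Import numFieldNormedType.Exports.

Local Open Scope classical_set_scope.
Local Open Scope fset_scope.
Local Open Scope ring_scope.

(* A Laurent polynomial with spectrum L is given by its coefficients; the values
   of [a] outside L play no role. *)
Definition laurent (R : realType) (L : {fset int}) (a : int -> R[i])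
    (z : R[i]) : R[i] :=
  \sum_(m <- L) a m * z ^ m.

Definition unit_circle (R : realType) : set R[i] := [set z | `|z| = 1].

Definition real_laurent (R : realType) (L : {fset int}) (a : int -> R[i]) :=
  forall z, unit_circle z -> laurent L a z \is Num.real.

Definition circle_point (R : realType) (t : R) : R[i] := (cos t +i* sin t)%C.

(* For a real Laurent polynomial, this real part is the value itself. *)
Definition circle_restriction (R : realType) (L : {fset int}) (a : int -> R[i])
    (t : R) : R :=
  complex.Re (laurent L a (circle_point t)).

Definition Trig (R : realType) (L : {fset int}) : set (R -> R) :=
  [set f | exists alpha beta : int -> R, forall t,
     f t = \sum_(k <- L) (alpha k * cos (k%:~R * t) + beta k * sin (k%:~R * t))].

Definition trig_inner (R : realType) (f g : R -> R) : R :=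
  \int[lebesgue_measure]_(t in `[0, 2 * pi]) (f t * g t).

Definition trig_orthonormal_basis (R : realType) (L : {fset int}) (n : nat)
    (e : 'I_n -> R -> R) : Prop :=
  [/\ forall i, Trig L (e i),
      forall i j, trig_inner (e i) (e j) = (i == j)%:R
    & forall g, Trig L g ->
        exists c : 'I_n -> R, forall t, g t = \sum_(i < n) c i * e i t].

(* The standard Gaussian measure of a Euclidean space is the image of the
   n-fold power of N(0,1) under the isometry given by an orthonormal basis; by
   rotation invariance it does not depend on the basis.  That the joint law of
   the coordinates xi_i is this power is expressed on measurable boxes. *)
Definition standard_gaussian_trig (R : realType) (L : {fset int})
    (d : measure_display) (T : measurableType d) (P : probability T R)
    (F : T -> R -> R) : Prop :=
  exists (n : nat) (e : 'I_n -> R -> R) (xi : 'I_n -> {RV P >-> R}),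
    [/\ trig_orthonormal_basis L e,
        forall w t, F w t = \sum_(i < n) xi i w * e i t
      & forall B : 'I_n -> set R, (forall i, measurable (B i)) ->
          P [set w | forall i, B i (xi i w)] =
          (\prod_(i < n) normal_prob 0%R 1%R (B i))%E].

Definition random_real_laurent (R : realType) (L : {fset int})
    (d : measure_display) (T : measurableType d) (P : probability T R)
    (a : T -> int -> R[i]) : Prop :=
  (forall w, real_laurent L (a w)) /\
  standard_gaussian_trig L P (fun w => circle_restriction L (a w)).

Definition real_roots (R : realType) (L : {fset int}) (a : int -> R[i]) :
    set R[i] :=
  [set z | unit_circle z /\ laurent L a z = 0].

(* Number of distinct real roots, +oo if there are infinitely many. *)
Definition nb_real_roots (R : realType) (L : {fset int}) (a : int -> R[i]) :
    \bar R :=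
  counting (real_roots L a).

Definition spectrum_degree (L : {fset int}) : nat := (\max_(m <- L) absz m)%N.

(* z ^ spectrum_degree L * laurent L a z, as a polynomial: the exponents
   m + spectrum_degree L are nonnegative for m in L. *)
Definition cleared_laurent (R : realType) (L : {fset int}) (a : int -> R[i]) :
    {poly R[i]} :=
  \sum_(m <- L) a m *: 'X^(absz (m + (spectrum_degree L)%:Z)).

(* Number of roots in C \ {0} counted with multiplicity.  The sum has finite
   support; it is 0 for the zero polynomial, a case of probability 0. *)
Definition nb_roots (R : realType) (L : {fset int}) (a : int -> R[i]) : R :=
  \sum_(z \in [set z : R[i] | z != 0]) ((mup z (cleared_laurent L a))%:R : R).

Definition expected_nb_real_roots (R : realType) (L : {fset int})
    (d : measure_display) (T : measurableType d) (P : probability T R)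
    (a : T -> int -> R[i]) : \bar R :=
  (\int[P]_w nb_real_roots L (a w))%E.

Definition real_root_probability (R : realType) (L : {fset int})
    (d : measure_display) (T : measurableType d) (P : probability T R)
    (a : T -> int -> R[i]) : \bar R :=
  (\int[P]_w (nb_real_roots L (a w) / (nb_roots L (a w))%:E))%E.

(* Main.v *)
(* Kac-Rice is bypassed by counting sign changes on a regular grid.  The
   reproducing kernel of Trig L is (2 pi)^-1 * sum_(k in L) cos (k (s - t)), so
   the values of F at two points at distance h form a Gaussian pair with
   correlation cos th = (#L)^-1 * sum_k cos (k h), and rotation invariance of
   the plane Gaussian measure gives a sign change with probability th / pi.
   Summing over a grid of mesh h = 2 pi / N and letting N grow, the expected
   number of sign changes tends to 2 * sqrt ((#L)^-1 * sum_k k^2).  The number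
   of sign changes never exceeds the number of zeros (intermediate values), and
   almost surely its liminf is the number of zeros, since double zeros have
   probability 0; Fatou's lemma then yields (a).  For (b), the extreme
   coefficients are almost surely nonzero, which fixes the number of roots. *)
Require Import Defs.
From HB Require Import structures.
From mathcomp Require Import all_boot all_order all_algebra finmap.
From mathcomp Require Import all_classical all_reals all_analysis measurable_realfun.
From mathcomp Require Import complex ring lra zify.

Set Implicit Arguments.
Unset Strict Implicit.
Unset Printing Implicit Defensive.

Import Order.TTheory GRing.Theory Num.Theory.
Import numFieldNormedType.Exports.

Local Open Scope classical_set_scope.
Local Open Scope ring_scope.

(** * Rotation invariance of the plane Gaussian measure *)

(** The law of the coordinates is given on boxes of one orthonormal basis, while a sign change
    involves two values of [F], that is, two oblique linear forms. Uniqueness of product measures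
    passes from boxes to all Borel sets of the plane, and successive rotations of two coordinates
    bring both forms into a single coordinate plane; Gaussian computations thus stay
    two-dimensional. Double zeros are excluded without a joint density of [F] and its derivative. At
    a double zero both ends of the surrounding cell carry values of order h^2. Neighbouring values
    have correlation 1 - O(h^2), hence an independent component of size about h, so this has
    probability O(h^4 / h) in one cell and O(h^2) over the 2 pi / h cells. The angle th is of order
    h and is found through sin (th / 2), because acos is singular at 1. The number of zeros is not
    shown to be measurable: it is compared off a null set with the liminf of the sign changes, which
    is. *)

Section PlaneShears.
Context {R : realType}.
Local Notation mu := (@lebesgue_measure R).

Lemma lebesgue_measure_translate (c : R) (A : set R) : measurable A ->
  mu ((fun x => x + c) @^-1` A) = mu A.
Proof.
move=> mA.
have mf : measurable_fun [set: measurableTypeR R]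
    ((fun x => x + c) : measurableTypeR R -> measurableTypeR R).
  exact: measurable_funD.
rewrite -[LHS]/(pushforward mu ((fun x => x + c) :
  measurableTypeR R -> measurableTypeR R) A).
symmetry; apply: lebesgue_measure_unique => //.
move=> X [[a b] _ <-] /=; rewrite /pushforward.
rewrite (_ : _ @^-1` _ = `]a - c, b - c]%classic).
  rewrite !lebesgue_measure_itv/= !lte_fin ltrD2r.
  by case: ifP => // _; rewrite -!EFinB; congr EFin; ring.
by apply/seteqP; split => x/=; rewrite !in_itv/= ltrBlDr lerBrDr.
Qed.

Local Notation mu2 := (mu \x mu)%E.

Definition hshear (a : R) (z : R * R) := (z.1 + a * z.2, z.2).
Definition vshear (a : R) (z : R * R) := (z.1, z.2 + a * z.1).

Lemma measurable_hshear a : measurable_fun setT (hshear a).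
Proof.
apply/measurable_fun_pairP; split; last exact: measurable_snd.
by apply: measurable_funD => //; apply: measurable_funM.
Qed.

Lemma measurable_vshear a : measurable_fun setT (vshear a).
Proof.
apply/measurable_fun_pairP; split; first exact: measurable_fst.
by apply: measurable_funD => //; apply: measurable_funM.
Qed.

(** At a fixed first coordinate the shear translates the second one by a constant, so translation
    invariance preserves every slice. Rectangles suffice, by uniqueness of the product measure; no
    change of variables formula with a Jacobian is involved. *)
Lemma vshear_invariant a (C : set (R * R)) : measurable C ->
  mu2 (vshear a @^-1` C) = mu2 C.
Proof.
move=> mC.
have mv : measurable_fun [set: measurableTypeR R * measurableTypeR R]
    (vshear a : _ -> measurableTypeR R * measurableTypeR R).
  exact: measurable_vshear.
rewrite -[LHS]/(pushforward mu2 (vshear a :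
   measurableTypeR R * measurableTypeR R -> measurableTypeR R * measurableTypeR R) C).
symmetry; apply: product_measure_unique => //= A B mA mB.
rewrite /pushforward /product_measure1 /=.
under eq_integral => x _.
  rewrite (_ : mu _ = mu B * (\1_A x)%:E)%E; last first.
    rewrite indicE; have [xA|xA] := boolP (x \in A).
      rewrite mule1 -(lebesgue_measure_translate (a * x) mB); congr (mu _).
      apply/seteqP; split => y; rewrite /xsection/= ?inE/= => //.
      - by case.
      - by split => //; rewrite inE in xA.
    rewrite mule0 -[RHS](@measure0 _ _ _ mu); congr (mu _).
    apply/seteqP; split => y; rewrite /xsection/= ?inE//= => -[]/= xA'.
    by move: xA; rewrite notin_setE.
  over.
rewrite ge0_integralZl//=.
- by rewrite integral_indic// setIT muleC.
- exact/measurable_EFinP.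
Qed.

(** The horizontal shear is the vertical one conjugated by the exchange of coordinates, which
    preserves the area. *)
Lemma hshear_invariant a (C : set (R * R)) : measurable C ->
  mu2 (hshear a @^-1` C) = mu2 C.
Proof.
have mswap : measurable_fun [set: R * R] (fun z : R * R => (z.2, z.1)).
  by apply/measurable_fun_pairP; split; [exact: measurable_snd|exact: measurable_fst].
have sw (D : set (R * R)) : measurable D -> mu2 ((fun z : R * R => (z.2, z.1)) @^-1` D) = mu2 D.
  move=> mD.
  have ms : measurable_fun [set: measurableTypeR R * measurableTypeR R]
    ((fun z : R * R => (z.2, z.1)) : _ -> measurableTypeR R * measurableTypeR R) by exact: mswap.
  rewrite -[LHS]/(pushforward mu2 ((fun z : R * R => (z.2, z.1)) :
   measurableTypeR R * measurableTypeR R -> measurableTypeR R * measurableTypeR R) D).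
  symmetry; apply: product_measure_unique => //= A B mA mB.
  rewrite /pushforward (_ : _ @^-1` _ = B `*` A) ?product_measure1E 1?muleC//.
  by apply/seteqP; split => -[x y]/= [].
move=> mC; have mC1 : measurable ((fun z : R * R => (z.2, z.1)) @^-1` C).
  by rewrite -[X in measurable X]setTI; exact: mswap.
have mC2 : measurable (hshear a @^-1` C).
  by rewrite -[X in measurable X]setTI; exact: measurable_hshear.
by rewrite -[RHS]sw// -[RHS](vshear_invariant a)// -[LHS]sw.
Qed.

Definition rotation (c s : R) (z : R * R) := (c * z.1 + s * z.2, c * z.2 - s * z.1).

Lemma measurable_rotation c s : measurable_fun setT (rotation c s).
Proof.
apply/measurable_fun_pairP; split => /=.
  by apply: measurable_funD; apply: measurable_funM.
by apply: measurable_funB; apply: measurable_funM.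
Qed.

(* A plane rotation by an angle t not in pi Z is a product of three shears, the
   outer ones with coefficient tan (t / 2) = (1 - cos t) / sin t. *)
Lemma rotation_shears c s : s != 0 -> c ^+ 2 + s ^+ 2 = 1 ->
  rotation c s = hshear ((1 - c) / s) \o vshear (- s) \o hshear ((1 - c) / s).
Proof.
move=> s0 cs; apply/funext => -[x y]; rewrite /rotation /hshear /vshear /=.
have cs' : s ^+ 2 = 1 - c ^+ 2 by rewrite -cs; ring.
congr pair; last by field.
have -> : c * x + s * y = c * x + s ^+ 2 / s * y by rewrite expr2 mulfK.
by rewrite cs'; field.
Qed.

Lemma rotation_invariant c s (C : set (R * R)) : s != 0 ->
  c ^+ 2 + s ^+ 2 = 1 -> measurable C -> mu2 (rotation c s @^-1` C) = mu2 C.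
Proof.
move=> s0 cs mC; rewrite rotation_shears//.
have m1 : measurable (hshear ((1 - c) / s) @^-1` C).
  by rewrite -[X in measurable X]setTI; exact: measurable_hshear.
rewrite comp_preimage comp_preimage hshear_invariant ?vshear_invariant//.
  exact: hshear_invariant.
by rewrite -[X in measurable X]setTI; exact: measurable_vshear.
Qed.

(** * The standard Gaussian measure of the plane *)

Local Notation phi := (@normal_pdf R 0 1).

Let density (z : R * R) := (phi z.1 * phi z.2)%:E.

Let measurable_density : measurable_fun [set: R * R] density.
Proof.
apply/measurable_EFinP; apply: measurable_funM.
  by apply: measurableT_comp => //; exact: measurable_normal_pdf.
by apply: measurableT_comp => //; exact: measurable_normal_pdf.
Qed.

Let density_ge0 z : (0 <= density z)%E.
Proof. by rewrite lee_fin mulr_ge0 ?normal_pdf_ge0. Qed.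

Let density_rotation c s z : c ^+ 2 + s ^+ 2 = 1 ->
  density (rotation c s z) = density z.
Proof.
move=> cs; rewrite /density /rotation/= !normal_pdfE ?oner_neq0//.
rewrite /normal_fun !subr0; congr EFin.
rewrite mulrACA -expRD [RHS]mulrACA -expRD; congr (_ * expR _).
by rewrite -!mulrDl; congr (_ / _); rewrite -[RHS]mul1r -cs; ring.
Qed.

(** The product of two standard normal laws, presented by a density with respect to area: in this
    form its rotation invariance splits into that of the density and that of the area. *)
Let gauss2 (C : set (measurableTypeR R * measurableTypeR R)) : \bar R :=
  (\int[mu2]_(z in C) density z)%E.

Let gauss2_0 : gauss2 set0 = 0%E.
Proof. by rewrite /gauss2 integral_set0. Qed.

Let gauss2_ge0 A : (0 <= gauss2 A)%E.
Proof. by apply: integral_ge0. Qed.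

Let gauss2_sigma_additive : semi_sigma_additive gauss2.
Proof.
move=> /= A mA tA mUA; rewrite /gauss2/= ge0_integral_bigcup//=.
  apply: is_cvg_ereal_nneg_natsum_cond => n _ _.
  by apply: integral_ge0.
exact: measurable_funS measurable_density.
Qed.

HB.instance Definition _ := isMeasure.Build _ _ _
  gauss2 gauss2_0 gauss2_ge0 gauss2_sigma_additive.

Local Notation gamma := (@normal_prob R 0 1).

Let gamma2E C : measurable C -> (gamma \x gamma)%E C = gauss2 C.
Proof.
move=> mC; apply: product_measure_unique => //= A B mA mB.
rewrite /gauss2 integral_mkcond fubini_tonelli1/=; last 2 first.
- apply/(measurable_restrictT _ _).1; first exact: measurableX.
  exact: measurable_funS measurable_density.
- by move=> z; rewrite patchE; case: ifP.
rewrite /fubini_F /=.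
under eq_integral => x _.
  under eq_integral => y _.
    rewrite (_ : (density \_ (A `*` B)) (x, y) =
      ((EFin \o phi) \_ A) x * ((EFin \o phi) \_ B) y)%E; last first.
      rewrite !patchE in_setX/=; case: (x \in A); case: (y \in B) => /=.
      + by rewrite /density/= EFinM.
      + by rewrite mule0.
      + by rewrite mul0e.
      + by rewrite mul0e.
    over.
  rewrite ge0_integralZl//=; last 3 first.
  - apply/(measurable_restrictT _ _).1 => //; apply/measurable_EFinP.
    exact: measurable_funS (measurable_normal_pdf _ _).
  - by move=> y _; rewrite patchE; case: ifP => //= _; rewrite lee_fin normal_pdf_ge0.
  - by rewrite patchE; case: ifP => //= _; rewrite lee_fin normal_pdf_ge0.
  over.
rewrite ge0_integralZr//=; last 3 first.
- apply/(measurable_restrictT _ _).1 => //; apply/measurable_EFinP.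
  exact: measurable_funS (measurable_normal_pdf _ _).
- by move=> y _; rewrite patchE; case: ifP => //= _; rewrite lee_fin normal_pdf_ge0.
- apply: integral_ge0 => y _.
  by rewrite patchE; case: ifP => //= _; rewrite lee_fin normal_pdf_ge0.
by rewrite -!integral_mkcond.
Qed.

Lemma gauss_rotation c s (C : set (R * R)) : s != 0 -> c ^+ 2 + s ^+ 2 = 1 ->
  measurable C -> (gamma \x gamma)%E (rotation c s @^-1` C) = (gamma \x gamma)%E C.
Proof.
move=> s0 cs mC.
have mrot : measurable_fun [set: measurableTypeR R * measurableTypeR R]
    (rotation c s : _ -> measurableTypeR R * measurableTypeR R).
  exact: measurable_rotation.
have mrC : measurable (rotation c s @^-1` C).
  by rewrite -[X in measurable X]setTI; exact: measurable_rotation.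
rewrite !gamma2E// /gauss2.
transitivity (\int[mu2]_(z in rotation c s @^-1` C) (density \o rotation c s) z)%E.
  by apply: eq_integral => z _ /=; rewrite density_rotation.
pose rot' : measurableTypeR R * measurableTypeR R ->
  measurableTypeR R * measurableTypeR R := rotation c s.
(* The change of variables is an integral against the image of the area under the rotation, and this
   image is the area itself. *)
transitivity (\int[pushforward mu2 rot']_(z in C) density z)%E.
  symmetry; apply: (ge0_integral_pushforward mrot mu2) => //.
  exact: measurable_funS measurable_density.
apply: eq_measure_integral => A mA _.
by rewrite /= /pushforward; apply: rotation_invariant.
Qed.

End PlaneShears.

(** * Gaussian families *)

Section GaussianFamilies.
Context {R : realType} (d : measure_display) (T : measurableType d).
Context (P : probability T R).
Local Notation gamma := (@normal_prob R 0 1).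

Lemma normal_prob_prodX (A B : set R) : measurable A -> measurable B ->
  (gamma \x gamma)%E (A `*` B) = (gamma A * gamma B)%E.
Proof. by move=> mA mB; exact: product_measure1E. Qed.

(** Passage from rectangles to Borel sets in the presence of an event [E], which later constrains
    the remaining coordinates. For [p != 0], restricting [P] to [E], pushing forward and dividing by
    [p] gives a measure equal to the product on rectangles; for [p = 0] the event [E] is null. *)
Lemma gauss_joint_law (E : set T) (p : R) (X Y : T -> R) :
  measurable E -> measurable_fun setT X -> measurable_fun setT Y -> 0 <= p ->
  (forall A B, measurable A -> measurable B ->
    P (E `&` (X @^-1` A `&` Y @^-1` B)) = p%:E * (gamma A * gamma B))%E ->
  forall C, measurable C ->
  P (E `&` (fun w => (X w, Y w)) @^-1` C) = (p%:E * (gamma \x gamma) C)%E.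
Proof.
move=> mE mX mY p0 PE C mC.
have mXY : measurable_fun [set: T] (fun w => (X w, Y w)).
  by apply/measurable_fun_pairP; split.
have mXYC : measurable ((fun w => (X w, Y w)) @^-1` C).
  by rewrite -[X in measurable X]setTI; exact: mXY.
have [p00|p_neq0] := eqVneq p 0.
  rewrite p00 mul0e; apply/eqP; rewrite eq_le measure_ge0 andbT.
  have PE0 : P E = 0%E.
    have := PE setT setT measurableT measurableT.
    by rewrite p00 mul0e !preimage_setT !setIT.
  by rewrite -[leRHS]PE0 le_measure ?inE//; exact: measurableI.
have pV0 : 0 <= p^-1 by rewrite invr_ge0.
pose XY : T -> measurableTypeR R * measurableTypeR R := fun w => (X w, Y w).
have mXY' : measurable_fun setT XY by exact: mXY.
pose m := mscale (NngNum pV0) (pushforward (mrestr P mE) XY).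
have -> : (gamma \x gamma)%E C = m mXY' C.
  apply: product_measure_unique => //= A B mA mB.
  rewrite /m /mscale/= /pushforward /mrestr setIC.
  rewrite (_ : XY @^-1` _ = X @^-1` A `&` Y @^-1` B)//.
  by rewrite PE// muleA -EFinM mulVf// mul1e.
rewrite /m /mscale/= /pushforward /mrestr setIC.
by rewrite muleA -EFinM mulfV// mul1e.
Qed.

Definition gauss_family n (xi : 'I_n -> T -> R) :=
  (forall i, measurable_fun setT (xi i)) /\
  (forall B : 'I_n -> set R, (forall i, measurable (B i)) ->
     P [set w | forall i, B i (xi i w)] = (\prod_(i < n) gamma (B i))%E).

Definition dotp n (u v : 'I_n -> R) := \sum_(i < n) u i * v i.

(** Orthogonal maps enter only through these two properties, which are stable under composition;
    this replaces orthogonal matrices and the Gaussian law in dimension [n]. *)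
Definition gauss_isometry n (A : ('I_n -> R) -> 'I_n -> R) :=
  (forall u v, dotp (A u) (A v) = dotp u v) /\
  (forall xi, gauss_family xi -> gauss_family (fun k w => A (xi^~ w) k)).

Definition givens n (i j : 'I_n) (c s : R) (u : 'I_n -> R) (k : 'I_n) :=
  if k == i then c * u i + s * u j else
  if k == j then c * u j - s * u i else u k.

Lemma givens_dotp n (i j : 'I_n) c s u v : i != j -> c ^+ 2 + s ^+ 2 = 1 ->
  dotp (givens i j c s u) (givens i j c s v) = dotp u v.
Proof.
move=> ij cs; rewrite /dotp (bigD1 i)//= (bigD1 j)/=; last by rewrite eq_sym.
rewrite [RHS](bigD1 i)//= [in RHS](bigD1 j)/=; last by rewrite eq_sym.
rewrite !addrA; congr (_ + _).
  rewrite /givens !eqxx eq_sym (negbTE ij).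
  by rewrite -[RHS]mul1r -cs; ring.
by apply: eq_bigr => k /andP[/negbTE ki /negbTE kj]; rewrite /givens ki kj.
Qed.

Lemma measurable_forall_ord n (Q : 'I_n -> set T) :
  (forall k, measurable (Q k)) -> measurable [set w | forall k, Q k w].
Proof.
move=> mQ; rewrite (_ : mkset _ = \bigcap_(k in [set: 'I_n]) Q k).
  by apply: fin_bigcap_measurable => //; exact: finite_finset.
by apply/seteqP; split => w/= H => [k _|k]; exact: H.
Qed.

(** Only coordinates [i] and [j] move. With the box conditions on all others gathered in one event,
    the law of the remaining pair is a multiple of the plane Gaussian measure, which the rotation
    preserves. *)
Lemma givens_gauss n (i j : 'I_n) c s xi : i != j -> s != 0 ->
  c ^+ 2 + s ^+ 2 = 1 -> gauss_family xi ->
  gauss_family (fun k w => givens i j c s (xi^~ w) k).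
Proof.
move=> ij s0 cs [mxi xiP]; have ji : j != i by rewrite eq_sym.
split=> [k|B mB].
  rewrite /givens; case: (k == i); last case: (k == j) => //.
    by apply: measurable_funD; apply: measurable_funM.
  by apply: measurable_funB; apply: measurable_funM.
have mpre k (A : set R) : measurable A -> measurable (xi k @^-1` A).
  by move=> mA; rewrite -[X in measurable X]setTI; exact: mxi.
pose E := [set w | forall k, k != i -> k != j -> B k (xi k w)].
have mE : measurable E.
  apply: (measurable_forall_ord (Q := fun k => [set w |
    k != i -> k != j -> B k (xi k w)])) => k.
  have [ki|ki] := boolP (k == i).
    by rewrite (_ : mkset _ = setT)//; apply/seteqP; split.
  have [kj|kj] := boolP (k == j).
    by rewrite (_ : mkset _ = setT)//; apply/seteqP; split.
  rewrite (_ : mkset _ = xi k @^-1` B k); first exact: mpre.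
  by apply/seteqP; split => w/=; [exact|].
pose pe := (\prod_(k < n | (k != i) && (k != j)) gamma (B k))%E.
have pefin : pe \is a fin_num.
  apply: prode_fin_num => k _; rewrite ge0_fin_numE ?measure_ge0//.
  have le1 : (gamma (B k) <= 1)%E := probability_le1 gamma (mB k).
  by rewrite (le_lt_trans le1)// ltry.
have pe0 : 0 <= fine pe.
  by apply: fine_ge0; apply: prode_ge0 => k _; exact: measure_ge0.
have rect A A' : measurable A -> measurable A' ->
    P (E `&` (xi i @^-1` A `&` xi j @^-1` A')) =
    ((fine pe)%:E * (gamma A * gamma A'))%E.
  move=> mA mA'.
  pose B' k := if k == i then A else if k == j then A' else B k.
  have mB' k : measurable (B' k) by rewrite /B'; case: ifP => // _; case: ifP.
  transitivity (P [set w | forall k, B' k (xi k w)]).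
    congr (P _); apply/seteqP; split => w /=.
      move=> [Ew [wA wA']] k; rewrite /B'.
      case: ifPn => [/eqP->//|ki]; case: ifPn => [/eqP->//|kj]; exact: Ew.
    move=> H; split; last split.
    - by move=> k ki kj; have := H k; rewrite /B' (negbTE ki) (negbTE kj).
    - by have := H i; rewrite /B' eqxx.
    - by have := H j; rewrite /B' (negbTE ji) eqxx.
  rewrite xiP// (bigD1 i)//= (bigD1 j)//= {1}/B' eqxx {1}/B' (negbTE ji) eqxx.
  rewrite muleA muleC fineK//; congr (_ * _)%E.
  by apply: eq_bigr => k /andP[/negbTE ki /negbTE kj]; rewrite /B' ki kj.
have law := gauss_joint_law mE (mxi i) (mxi j) pe0 rect.
rewrite (_ : mkset _ =
    E `&` (fun w => (xi i w, xi j w)) @^-1` (rotation c s @^-1` (B i `*` B j))).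
  rewrite law; last first.
    by rewrite -[X in measurable X]setTI; apply: measurable_rotation => //;
      exact: measurableX.
  rewrite gauss_rotation//; last exact: measurableX.
  rewrite normal_prob_prodX// (bigD1 i)//= (bigD1 j)//= fineK//.
  by rewrite [RHS]muleA [RHS]muleC.
apply/seteqP; split => w /=.
  move=> H; split; last split.
  - by move=> k ki kj; have := H k; rewrite /givens (negbTE ki) (negbTE kj).
  - by have := H i; rewrite /givens eqxx.
  - by have := H j; rewrite /givens eqxx (negbTE ji).
move=> [Ew [Bi Bj]] k; rewrite /givens.
case: ifPn => [/eqP->//|ki]; case: ifPn => [/eqP->//|kj]; exact: Ew.
Qed.

Lemma givens_isometry n (i j : 'I_n) c s : i != j -> s != 0 ->
  c ^+ 2 + s ^+ 2 = 1 -> gauss_isometry (givens i j c s).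
Proof.
by move=> ij s0 cs; split => *; [exact: givens_dotp|exact: givens_gauss].
Qed.

(** Givens elimination: each [j] in [S] is cleared by a rotation in the plane of [i] and [j], its
    mass being collected at [i]. The last two conclusions control what happens to other coordinates
    and other vectors, so that a second alignment does not spoil a first one. *)
Lemma gauss_isometry_align n (i : 'I_n) (S : seq 'I_n) (u : 'I_n -> R) :
  i \notin S -> exists A, [/\ gauss_isometry A,
    forall k, k \in S -> A u k = 0,
    forall v k, k \notin i :: S -> A v k = v k &
    forall v, (forall k, k \in i :: S -> v k = 0) ->
      forall k, k \in i :: S -> A v k = 0].
Proof.
elim: S => [_|j S IH].
  by exists id; split => //.
rewrite inE negb_or => /andP[ij iS]; have [A [[Ad Ag] Au Afix A0]] := IH iS.
have [uj0|uj0] := eqVneq (A u j) 0.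
  exists A; split => //.
  - by move=> k; rewrite inE => /orP[/eqP->//|/Au].
  - move=> v k; rewrite !inE !negb_or => /and3P[ki kj kS].
    by rewrite Afix// inE negb_or ki.
  - move=> v v0 k; rewrite !inE => /or3P[ki|/eqP->|kS].
    + by apply: A0; rewrite ?inE ?ki// => l lS; apply: v0; move: lS;
        rewrite !inE => /orP[->//|->]; rewrite !orbT.
    + have [jS|jS] := boolP (j \in i :: S).
        by apply: A0 => // l lS; apply: v0; move: lS;
        rewrite !inE => /orP[->//|->]; rewrite !orbT.
      by rewrite Afix// v0// !inE eqxx orbT.
    + by apply: A0; rewrite ?inE ?kS ?orbT// => l lS; apply: v0; move: lS;
        rewrite !inE => /orP[->//|->]; rewrite !orbT.
(* The rotation with cosine [A u i / r] and sine [A u j / r] sends the pair [(A u i, A u j)] to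
   [(r, 0)]. *)
pose r := Num.sqrt (A u i ^+ 2 + A u j ^+ 2).
have r2 : r ^+ 2 = A u i ^+ 2 + A u j ^+ 2.
  by rewrite sqr_sqrtr// addr_ge0// sqr_ge0.
have r0 : r != 0.
  rewrite sqrtr_eq0 -ltNge; apply: ltr_wpDl; first exact: sqr_ge0.
  by rewrite exprn_even_gt0.
have s0 : A u j / r != 0 by rewrite mulf_neq0// invr_eq0.
have cs : (A u i / r) ^+ 2 + (A u j / r) ^+ 2 = 1.
  by rewrite !expr_div_n -mulrDl -r2 divff// expf_neq0.
have [Gd Gg] := givens_isometry ij s0 cs.
exists (givens i j (A u i / r) (A u j / r) \o A); split.
- by split => [v w|xi /Ag /Gg//]; rewrite /= Gd Ad.
- move=> k; rewrite inE /= /givens => /orP[/eqP->|kS].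
    by rewrite eq_sym (negbTE ij) eqxx; field.
  case: ifP => [/eqP ki|_]; last by case: ifP => [_|_]; [field|exact: Au].
  by rewrite -ki kS in iS.
- move=> v k; rewrite !inE !negb_or => /and3P[ki kj kS].
  by rewrite /= /givens (negbTE ki) (negbTE kj) Afix// inE negb_or ki.
- move=> v v0.
  have Av l : l \in i :: S -> A v l = 0.
    move=> lS; apply: A0 => // m mS; apply: v0; move: mS.
    by rewrite !inE => /orP[->//|->]; rewrite !orbT.
  have Avj : A v j = 0.
    have [jS|jS] := boolP (j \in i :: S); first exact: Av.
    by rewrite Afix// v0// !inE eqxx orbT.
  have Avi : A v i = 0 by apply: Av; rewrite inE eqxx.
  move=> k; rewrite /= /givens Avi Avj !mulr0 subrr addr0.
  by rewrite !inE; case: ifP => //= _; case: ifP => //= _ kS; rewrite Av// inE kS orbT.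
Qed.

Definition lin n (xi : 'I_n -> T -> R) (u : 'I_n -> R) (w : T) :=
  dotp u (xi^~ w).

Definition gauss_pair (X Y : T -> R) :=
  [/\ measurable_fun setT X, measurable_fun setT Y &
   forall C, measurable C ->
     P ((fun w => (X w, Y w)) @^-1` C) = (gamma \x gamma)%E C].

Lemma gauss_family_pair n (xi : 'I_n -> T -> R) (i j : 'I_n) :
  i != j -> gauss_family xi -> gauss_pair (xi i) (xi j).
Proof.
move=> ij [mxi xiP]; split => // C mC.
rewrite -[X in P X]setTI (@gauss_joint_law _ 1) ?mul1e// => A B mA mB.
rewrite setTI mul1e.
pose B' k := if k == i then A else if k == j then B else setT.
have ji : (j == i) = false by rewrite eq_sym (negbTE ij).
transitivity (P [set w | forall k, B' k (xi k w)]).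
  congr (P _); apply/seteqP; split => w /=.
    by move=> [wA wB] k; rewrite /B'; case: eqP => [->//|_]; case: eqP => [->|_].
  by move=> H; split; [have := H i; rewrite /B' eqxx|
    have := H j; rewrite /B' eqxx ji].
rewrite xiP; last by move=> k; rewrite /B'; case: eqP => // _; case: eqP.
rewrite (bigD1 i)//= (bigD1 j) ?ji//= {1}/B' eqxx {1}/B' ji eqxx.
rewrite big1 ?mule1// => k /andP[/negbTE ki /negbTE kj].
by rewrite /B' ki kj; exact: probability_setT.
Qed.

Lemma gauss_pair_rotation (X Y : T -> R) c s : s != 0 -> c ^+ 2 + s ^+ 2 = 1 ->
  gauss_pair X Y ->
  gauss_pair (fun w => c * X w + s * Y w) (fun w => c * Y w - s * X w).
Proof.
move=> s0 cs [mX mY XY]; split.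
- by apply: measurable_funD; apply: measurable_funM.
- by apply: measurable_funB; apply: measurable_funM.
move=> C mC; rewrite -(gauss_rotation s0 cs mC) -XY//.
by rewrite -[X in measurable X]setTI; exact: measurable_rotation.
Qed.

Lemma dotp_delta n (i : 'I_n) (u v : 'I_n -> R) :
  (forall k, k != i -> u k = 0) -> dotp u v = u i * v i.
Proof.
by move=> u0; rewrite /dotp (bigD1 i)//= big1 ?addr0// => k /u0->; rewrite mul0r.
Qed.

(** After an isometry that aligns [u] with one axis, the form is a multiple of a single coordinate
    of the rotated family. *)
Lemma lin_standard_normal n (xi : 'I_n -> T -> R) (u : 'I_n -> R) :
  gauss_family xi -> dotp u u != 0 ->
  exists a (X : T -> R), [/\ a != 0, measurable_fun setT X,
    forall A, measurable A -> P (X @^-1` A) = gamma A &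
    forall w, lin xi u w = a * X w].
Proof.
move=> xiP uu.
have [i _] : exists2 i : 'I_n, true & u i * u i != 0.
  apply: contrapT => /forall2NP H; move/negP: uu; apply.
  rewrite /dotp big1// => i _; have [//|/negP] := H i.
  by rewrite negbK => /eqP.
move=> _; pose S := [seq k <- enum 'I_n | k != i].
have iS : i \notin S by rewrite mem_filter eqxx.
have [A [[Ad Ag] Au _ _]] := gauss_isometry_align u iS.
have Au0 k : k != i -> A u k = 0.
  by move=> ki; apply: Au; rewrite mem_filter ki mem_enum.
have [mA AP] := Ag _ xiP.
exists (A u i), (fun w => A (xi^~ w) i); split => //.
- apply: contraNneq uu => Aui; rewrite -Ad (dotp_delta _ Au0).
  by rewrite Aui mul0r.
- move=> B mB.
  pose B' k := if k == i then B else setT.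
  transitivity (P [set w | forall k, B' k (A (xi^~ w) k)]).
    congr (P _); apply/seteqP; split => w /=.
      by move=> wB k; rewrite /B'; case: eqP => [->//|].
    by move=> H; have := H i; rewrite /B' eqxx.
  rewrite AP; last by move=> k; rewrite /B'; case: eqP.
  rewrite (bigD1 i)//= {1}/B' eqxx big1 ?mule1// => k /negbTE ki.
  by rewrite /B' ki; exact: probability_setT.
- by move=> w; rewrite /lin -Ad (dotp_delta _ Au0).
Qed.

(** Gram-Schmidt by rotations: [u] is sent to the axis [i], then [v] into the plane of [i] and [j],
    which requires two coordinates. The factor [a] is determined only up to sign, hence the squares
    in the conclusion. *)
Lemma lin_gauss_pair n (xi : 'I_n -> T -> R) (u v : 'I_n -> R) (r c : R) :
  (1 < n)%N -> gauss_family xi -> 0 < r -> dotp u u = r ^+ 2 ->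
  dotp v v = r ^+ 2 -> dotp u v = r ^+ 2 * c ->
  exists a b (X Y : T -> R), [/\ a ^+ 2 = r ^+ 2, c ^+ 2 + b ^+ 2 = 1,
    gauss_pair X Y, forall w, lin xi u w = a * X w &
    forall w, lin xi v w = a * (c * X w + b * Y w)].
Proof.
move=> n1 xiP r0 uu vv uv.
pose i : 'I_n := Ordinal (ltnW n1); pose j : 'I_n := Ordinal n1.
have ij : i != j by [].
pose S := [seq k <- enum 'I_n | k != i].
pose S' := [seq k <- enum 'I_n | (k != i) && (k != j)].
have iS : i \notin S by rewrite mem_filter eqxx.
have jS' : j \notin S' by rewrite mem_filter eqxx andbF.
have [A [Ai Au _ _]] := gauss_isometry_align u iS.
(* This alignment acts on coordinates other than [i] only, and [A u] vanishes there; so [u] remains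
   on the axis [i]. *)
have [B [Bi Bv Bfix B0]] := gauss_isometry_align (A v) jS'.
pose C := B \o A.
have [Cd Cg] : gauss_isometry C.
  split => [x y|eta /(proj2 Ai)/(proj2 Bi)//].
  by rewrite /C/= (proj1 Bi) (proj1 Ai).
have Au0 k : k != i -> A u k = 0.
  by move=> ki; apply: Au; rewrite mem_filter ki mem_enum.
have Cu0 k : k != i -> C u k = 0.
  move=> ki; apply: B0 => [l|].
    rewrite inE mem_filter => /orP[/eqP->|/andP[/andP[li _] _]]; exact: Au0.
  by rewrite inE mem_filter ki mem_enum/= andbT orbN.
have Cv0 k : k != i -> k != j -> C v k = 0.
  by move=> ki kj; apply: Bv; rewrite mem_filter ki kj mem_enum.
have Cvw (x : 'I_n -> R) : dotp (C v) x = C v i * x i + C v j * x j.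
  rewrite /dotp (bigD1 i)//= (bigD1 j)//= big1 ?addr0//.
  by move=> k /andP[ki kj]; rewrite Cv0// mul0r.
have /gauss_family_pair := Cg _ xiP => /(_ _ _ ij) pair.
have a2 : C u i ^+ 2 = r ^+ 2 by rewrite -uu -Cd (dotp_delta _ Cu0) expr2.
have ad : C u i * C v i = r ^+ 2 * c by rewrite -uv -Cd (dotp_delta _ Cu0).
have db : C v i ^+ 2 + C v j ^+ 2 = r ^+ 2 by rewrite -vv -Cd Cvw !expr2.
have a0 : C u i != 0.
  by rewrite -sqrf_eq0 a2 sqrf_eq0 gt_eqF.
have cE : c = C v i / C u i.
  apply: (mulfI (x := r ^+ 2)); first by rewrite sqrf_eq0 gt_eqF.
  by rewrite -ad -a2; field.
exists (C u i), (C v j / C u i), (fun w => C (xi^~ w) i), (fun w => C (xi^~ w) j).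
split => //.
- by rewrite cE !expr_div_n -mulrDl db a2 divff// sqrf_eq0 gt_eqF.
- by move=> w; rewrite /lin -Cd (dotp_delta _ Cu0).
- by move=> w; rewrite /lin -Cd Cvw cE; field.
Qed.

End GaussianFamilies.

(** * The probability of a sign change *)

(** Cauchy's functional equation on an interval. Nonnegativity makes [f] monotone, so [f x] and
    [x / m * f m] both lie between [k] and [k.+1] times [f m / N], where [k] is the integer part of
    [N * x / m]; then [N] is arbitrarily large. *)
Lemma additive_linear {R : realType} (f : R -> R) (m : R) : 0 < m ->
  (forall x, 0 <= f x) ->
  (forall x y, 0 < x -> 0 < y -> x + y <= m -> f (x + y) = f x + f y) ->
  forall x, 0 < x -> x <= m -> f x = x / m * f m.
Proof.
move=> m0 f0 fD x x0 xm.
have fM n y : 0 < y -> n.+1%:R * y <= m -> f (n.+1%:R * y) = n.+1%:R * f y.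
  move=> y0; elim: n => [|n IH]; first by rewrite !mul1r.
  move=> nm; have nm' : n.+1%:R * y <= m.
    by apply: le_trans nm; rewrite ler_pM2r// ler_nat.
  rewrite -[in LHS]natr1 -[in RHS]natr1 !mulrDl !mul1r fD ?IH//.
    by rewrite mulr_gt0.
  by apply: le_trans nm; rewrite -[in leRHS]natr1 mulrDl mul1r.
have fle y z : 0 < y -> y <= z -> z <= m -> f y <= f z.
  move=> y0; rewrite le_eqVlt => /predU1P[->//|yz] zm.
  rewrite -(subrK y z) addrC fD ?lerDl// ?subr_gt0//.
  by rewrite addrC subrK.
have key n : `|f x - x / m * f m| <= f m / n.+1%:R.
  set N : R := n.+1%:R; have N0 : 0 < N by rewrite ltr0n.
  have mN0 : 0 < m / N by rewrite divr_gt0.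
  have fN : f (m / N) = f m / N.
    apply: (mulfI (x := N)); first by rewrite gt_eqF.
    have Nm y : N * (y / N) = y by rewrite mulrC divfK// gt_eqF.
    by rewrite -fM ?Nm.
  have y0 : 0 <= N * x / m by rewrite ltW// divr_gt0// mulr_gt0.
  have /andP[kl ku] := truncn_itv y0.
  set k := Num.truncn _ in kl ku.
  have kle : k%:R * (m / N) <= x.
    rewrite mulrA ler_pdivrMr// [x * N]mulrC -ler_pdivlMr//.
  have kgt : x < k.+1%:R * (m / N).
    by rewrite mulrA ltr_pdivlMr// [x * N]mulrC -ltr_pdivrMr.
  have lo : k%:R * (f m / N) <= f x.
    case: k kl ku kle kgt => [|k] kl ku kle kgt; first by rewrite mul0r.
    rewrite -fN -fM//; last exact: le_trans xm.
    by apply: fle => //; rewrite mulr_gt0.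
  have hi : f x <= k.+1%:R * (f m / N).
    have [kN|kN] := leP (k.+1%:R * (m / N)) m.
      by rewrite -fN -fM//; apply: fle => //; exact: ltW.
    apply: (@le_trans _ _ (f m)); first exact: fle.
    have Nk : N <= k.+1%:R.
      by move: kN; rewrite mulrA ltr_pdivlMr// mulrC ltr_pM2r// => /ltW.
    have -> : f m = N * (f m / N) by rewrite mulrC divfK// gt_eqF.
    by rewrite [N * _ / N]mulrAC divff ?gt_eqF// mul1r ler_wpM2r// divr_ge0// ltW.
  have fm0 : 0 <= f m / N by rewrite divr_ge0// ltW.
  have lo' : (k%:R : R) * (f m / N) <= x / m * f m.
    rewrite mulrCA [leRHS]mulrC; apply: ler_wpM2l => //.
    by rewrite ler_pdivlMr// mulrAC -mulrA.
  have hi' : x / m * f m <= k.+1%:R * (f m / N).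
    rewrite [leRHS]mulrCA [leLHS]mulrC; apply: ler_wpM2l => //.
    by rewrite ler_pdivrMr// mulrAC -mulrA ltW.
  rewrite ler_norml; move: lo hi lo' hi'; rewrite -natr1.
  set F := f m / N; set G := x / m * f m; move=> *; apply/andP; split; nra.
apply/eqP; rewrite -subr_eq0 -normr_le0; apply/ler_addgt0Pr => e e0.
rewrite add0r; have [n Hn] : exists n, f m / n.+1%:R <= e.
  exists (Num.truncn (f m / e)).
  rewrite ler_pdivrMr// mulrC -ler_pdivrMr// ltW//.
  by case/andP: (truncn_itv (divr_ge0 (f0 m) (ltW e0))).
exact: le_trans (key n) Hn.
Qed.

Section Sheppard.
Context {R : realType}.
Local Notation gamma := (@normal_prob R 0 1).
Local Notation gamma2 := (gamma \x gamma)%E.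

Definition linform (t : R) (z : R * R) := cos t * z.1 + sin t * z.2.

Lemma measurable_linform t : measurable_fun setT (linform t).
Proof. by apply: measurable_funD; apply: measurable_funM. Qed.

Lemma measurable_linform_eq0 t : measurable [set z | linform t z = 0].
Proof.
rewrite (_ : mkset _ = linform t @^-1` [set 0])// -[X in measurable X]setTI.
exact: measurable_linform.
Qed.

(** For [0 <= t - s <= pi] this is a pair of opposite open sectors of opening [t - s], bounded by
    the kernels of the two forms. *)
Definition opposite_sides (s t : R) := [set z | linform s z * linform t z < 0].

Lemma measurable_opposite_sides s t : measurable (opposite_sides s t).
Proof.
rewrite (_ : opposite_sides s t =
  (linform s \* linform t) @^-1` `]-oo, 0[%classic).
  rewrite -[X in measurable X]setTI.
  by apply: measurable_funM => //; exact: measurable_linform.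
by apply/seteqP; split => z /=; rewrite in_itv.
Qed.

Lemma linform_rotation s t z :
  linform t (rotation (cos s) (sin s) z) = linform (t + s) z.
Proof. by rewrite /linform /rotation/= cosD sinD; ring. Qed.

Lemma opposite_sides_rotation s t u : sin u != 0 ->
  gamma2 (opposite_sides (s + u) (t + u)) = gamma2 (opposite_sides s t).
Proof.
move=> u0; rewrite -[RHS](gauss_rotation u0 (cos2Dsin2 u)); last first.
  exact: measurable_opposite_sides.
congr (gamma2 _); apply/seteqP; split => z; rewrite /opposite_sides/=;
  by rewrite !linform_rotation.
Qed.

Lemma normal_prob_set1 (x : R) : gamma [set x] = 0%E.
Proof. by rewrite /normal_prob integral_set1. Qed.

(** A rotation carries the line to the vertical axis, a product with a null factor; when [sin t = 0]
    the line already is that axis. *)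
Lemma linform_eq0_null t : gamma2 [set z | linform t z = 0] = 0%E.
Proof.
have l0 : gamma2 [set z | z.1 = 0] = 0%E.
  rewrite (_ : mkset _ = [set 0] `*` setT).
    by rewrite normal_prob_prodX// normal_prob_set1 mul0e.
  by apply/seteqP; split => z //= [].
have [st|st] := eqVneq (sin t) 0.
  rewrite -[RHS]l0; congr (gamma2 _); apply/seteqP; split => z /=;
    rewrite /linform st mul0r addr0.
  - move/eqP; rewrite mulf_eq0 => /orP[/eqP c0|/eqP//].
    by have := cos2Dsin2 t; rewrite c0 st expr0n/= addr0 => /eqP; rewrite eq_sym oner_eq0.
  - by move=> ->; rewrite mulr0.
rewrite -[RHS]l0 -[RHS](gauss_rotation st (cos2Dsin2 t))//.
rewrite (_ : mkset _ = [set 0] `*` setT); first exact: measurableX.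
by apply/seteqP; split => z //= [].
Qed.

Lemma normal_prob_prodU0 (A B : set (R * R)) : measurable A -> measurable B ->
  gamma2 B = 0%E -> gamma2 (A `|` B) = gamma2 A.
Proof. by move=> mA mB B0; exact: measureU0. Qed.

Lemma normal_prob_prodD0 (A B : set (R * R)) : measurable A -> measurable B ->
  gamma2 B = 0%E -> gamma2 A = gamma2 (A `\` B).
Proof.
move=> mA mB B0; have mAB := measurableD mA mB.
rewrite -(normal_prob_prodU0 mAB mB B0) -(normal_prob_prodU0 mA mB B0).
by congr (gamma2 _); rewrite setUDl setDv setD0.
Qed.

Lemma normal_prob_prodU (A B : set (R * R)) : measurable A -> measurable B ->
  A `&` B = set0 -> gamma2 (A `|` B) = (gamma2 A + gamma2 B)%E.
Proof. by move=> mA mB AB; exact: measureU. Qed.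

Definition sector_prob (t : R) := fine (gamma2 (opposite_sides 0 t)).

Lemma opposite_sides_fin s t : gamma2 (opposite_sides s t) \is a fin_num.
Proof.
have le1 : (gamma2 (opposite_sides s t) <= gamma2 (setT `*` setT))%E.
  apply: le_measure; rewrite ?inE.
  - exact: measurable_opposite_sides.
  - exact: measurableX.
  - by move=> z.
rewrite ge0_fin_numE ?measure_ge0// (le_lt_trans le1)//.
have gT : gamma setT = 1%E := probability_setT gamma.
by rewrite normal_prob_prodX// gT mule1 ltry.
Qed.

Lemma sector_probE t : gamma2 (opposite_sides 0 t) = (sector_prob t)%:E.
Proof. by rewrite fineK// opposite_sides_fin. Qed.

(** The identity sin (s + t) l_s = sin t l_0 + sin s l_(s+t) has positive coefficients on the right:
    if the outer forms agree in sign, so does the middle one. Hence the sign changes at most once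
    between the three forms. At [s + t = pi] the left side vanishes, which still contradicts a
    strict sign on the right. *)
Lemma opposite_sides_split s t z : 0 < s -> 0 < t -> s + t <= pi ->
  linform 0 z != 0 -> linform s z != 0 -> linform (s + t) z != 0 ->
  (opposite_sides 0 (s + t) z <->
    opposite_sides 0 s z \/ opposite_sides s (s + t) z) /\
  ~ (opposite_sides 0 s z /\ opposite_sides s (s + t) z).
Proof.
move=> s0 t0 st.
have ss : 0 < sin s by apply: sin_gt0_pi; rewrite s0/=; lra.
have sin_t : 0 < sin t by apply: sin_gt0_pi; rewrite t0/=; lra.
have sst : 0 <= sin (s + t) by apply: sin_ge0_pi; rewrite st andbT addr_ge0// ltW.
have rel : sin (s + t) * linform s z = sin t * linform 0 z + sin s * linform (s + t) z.
  have sinE : sin t = sin (s + t) * cos s - cos (s + t) * sin s.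
    by rewrite -sinB addrAC subrr add0r.
  rewrite /linform cos0 sin0 sinE; set S := sin (s + t); set C := cos (s + t).
  by ring.
rewrite /opposite_sides/=.
set a := linform 0 z in rel *; set b := linform s z in rel *.
set c := linform (s + t) z in rel * => a0 b0 c0.
rewrite !mulr_lt0 a0 b0 c0/=.
have ge_gt (x : R) : x != 0 -> 0 <= x -> 0 < x by rewrite lt_neqAle eq_sym => -> ->.
have [an|/(ge_gt _ a0) ap] := ltP a 0; have [bn|/(ge_gt _ b0) bp] := ltP b 0;
  have [cn|/(ge_gt _ c0) cp] := ltP c 0 => /=;
  try first [by split; [split => [_|_]; [left|]|case]
    | by split; [split => [_|_]; [right|]|case]
    | by split; [split => [//|[]//]|case]].
- exfalso; have : 0 <= sin (s + t) * b by rewrite mulr_ge0// ltW.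
  by rewrite rel leNgt -oppr_gt0 opprD addr_gt0// -mulrN mulr_gt0 ?oppr_gt0.
- exfalso; have : sin (s + t) * b <= 0 by rewrite mulr_ge0_le0// ltW.
  by rewrite rel leNgt addr_gt0// mulr_gt0.
Qed.

(** The sector from [s] to [s + t] weighs as much as the one from [0] to [t] by rotation invariance;
    off three null lines the two adjacent sectors partition the large one. *)
Lemma sector_probD s t : 0 < s -> 0 < t -> s + t <= pi ->
  sector_prob (s + t) = sector_prob s + sector_prob t.
Proof.
move=> s0 t0 st; suff h : gamma2 (opposite_sides 0 (s + t)) =
    (gamma2 (opposite_sides 0 s) + gamma2 (opposite_sides 0 t))%E.
  by rewrite /sector_prob h fineD// opposite_sides_fin.
have ss : 0 < sin s by apply: sin_gt0_pi; rewrite s0/=; lra.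
rewrite -(@opposite_sides_rotation 0 t s) ?gt_eqF// add0r (addrC t s).
pose N := [set z | linform 0 z = 0] `|`
  ([set z | linform s z = 0] `|` [set z | linform (s + t) z = 0]).
have ml := measurable_linform_eq0.
have mN : measurable N by do 2!apply: measurableU => //.
have N0 : gamma2 N = 0%E.
  rewrite normal_prob_prodU0 ?linform_eq0_null//.
    exact: measurableU.
  by rewrite normal_prob_prodU0 ?linform_eq0_null.
have mo := measurable_opposite_sides.
have rmN A mA := @normal_prob_prodD0 A N mA mN N0.
rewrite (rmN _ (mo 0 (s + t))) (rmN _ (mo 0 s)) (rmN _ (mo s (s + t))).
have mD r u : measurable (opposite_sides r u `\` N) by exact: measurableD.
rewrite -(normal_prob_prodU (mD 0 s) (mD s (s + t))).
  congr (gamma2 _); apply/seteqP; split => z /=; rewrite /N/= !not_orP;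
    move=> H.
  - have [zst [/eqP z0 [/eqP zs /eqP zst0]]] := H.
    have [[H1 _] _] := opposite_sides_split s0 t0 st z0 zs zst0.
    by case: (H1 zst) => ?; [left|right]; split => //; case: H.
  - have [z0 [zs zst0]] : linform 0 z <> 0 /\ linform s z <> 0 /\ linform (s + t) z <> 0.
      by case: H => -[_].
    have [[_ H1] _] := opposite_sides_split s0 t0 st (introN eqP z0) (introN eqP zs) (introN eqP zst0).
    by split => //; apply: H1; case: H => -[? _]; [left|right].
apply/seteqP; split => z //= [[z1 H] [z2 _]].
move: H; rewrite /N/= !not_orP => -[/eqP z0 [/eqP zs /eqP zst0]].
by have [_] := opposite_sides_split s0 t0 st z0 zs zst0; apply.
Qed.

Lemma linform0 z : linform 0 z = z.1.
Proof. by rewrite /linform cos0 sin0 mul1r mul0r addr0. Qed.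

Lemma sector_prob_pi : sector_prob pi = 1.
Proof.
apply: EFin_inj; rewrite -(sector_probE pi).
have gT : gamma setT = 1%E := probability_setT gamma.
have g2T : gamma2 (setT `*` setT) = 1%E by rewrite normal_prob_prodX// gT mule1.
rewrite -[RHS]g2T; have ml0 := measurable_linform_eq0 0.
have mo := measurable_opposite_sides 0 pi.
apply: etrans (esym (normal_prob_prodU0 mo ml0 (linform_eq0_null 0))) _.
congr (gamma2 _); apply/seteqP; split => z //= _.
rewrite /opposite_sides/= !linform0 /linform cospi sinpi mul0r addr0 mulN1r mulrN.
have [->|z0] := eqVneq z.1 0; first by right.
by left; rewrite oppr_lt0 -expr2 exprn_even_gt0.
Qed.

Lemma sector_prob_angle t : 0 <= t <= pi -> sector_prob t = t / pi.
Proof.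
move=> /andP[]; rewrite le_eqVlt => /predU1P[<- _|t0 tpi].
  rewrite mul0r; apply: EFin_inj; rewrite -(sector_probE 0).
  rewrite -[RHS](@measure0 _ _ _ gamma2); congr (gamma2 _).
  apply/seteqP; split => z //=; rewrite /opposite_sides/=.
  by rewrite -expr2 ltNge sqr_ge0.
rewrite (additive_linear (pi_gt0 R) _ _ t0 tpi) ?sector_prob_pi ?mulr1//.
- by move=> x; apply: fine_ge0; exact: measure_ge0.
- by move=> x y x0 y0 xy; exact: sector_probD.
Qed.

(** * Two correlated Gaussian variables *)

Section PairEstimates.
Context (d : measure_display) (T : measurableType d) (P : probability T R).

(** Sheppard's formula: with t = acos c, the pair (c, b) is (cos t, sin t) or (cos t, - sin t), and
    the first case is a sector of opening t. *)
Lemma gauss_pair_sign_change (X Y : T -> R) c b : gauss_pair P X Y ->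
  c ^+ 2 + b ^+ 2 = 1 ->
  P [set w | X w * (c * X w + b * Y w) < 0] = (acos c / pi)%:E.
Proof.
move=> XY cb.
have c1 : -1 <= c <= 1.
  by rewrite -ler_norml -(ler_pXn2r (n := 2)) ?nnegrE// -normrX expr1n
    ger0_norm ?sqr_ge0// -cb lerDl sqr_ge0.
pose t := acos c.
have tpi : 0 <= t <= pi by rewrite acos_ge0//= acos_lepi.
have ct : cos t = c by rewrite acosK// in_itv.
have st0 : 0 <= sin t by exact: sin_ge0_pi.
have sb : sin t ^+ 2 = b ^+ 2 by rewrite sin2cos2 ct -cb; ring.
have key (Z W : T -> R) : gauss_pair P Z W ->
    P [set w | Z w * (c * Z w + sin t * W w) < 0] = (t / pi)%:E.
  move=> [_ _ ZW]; rewrite -(sector_prob_angle tpi) -sector_probE.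
  rewrite -ZW; last exact: measurable_opposite_sides.
  congr (P _); apply/seteqP; split => w /=; rewrite /opposite_sides/= linform0/=;
    by rewrite /linform/= ct.
have /orP[/eqP bE|/eqP bE] : (b == sin t) || (b == - sin t).
- by rewrite -eqf_sqr sb.
- by rewrite bE; exact: key.
have [s0|s0] := eqVneq (sin t) 0; first last.
  (* When b = - sin t, rotating the pair makes [c * X + b * Y] the new first variable Z and
     expresses [X] as c Z + sin t W. The product is unchanged and the first case applies. *)
  have cs : c ^+ 2 + (- sin t) ^+ 2 = 1 by rewrite sqrrN sb.
  have ns0 : - sin t != 0 by rewrite oppr_eq0.
  rewrite -(key _ _ (gauss_pair_rotation ns0 cs XY)) bE; congr (P _).
  have e w : c * (c * X w + - sin t * Y w) + sin t * (c * Y w - - sin t * X w) = X w.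
    by rewrite -[RHS]mulr1 -cs; ring.
  by apply/seteqP; split => w /=; rewrite e mulrC.
have -> : b = sin t by rewrite bE s0 oppr0.
exact: key.
Qed.

(** The density is at most its peak 1 / sqrt (2 pi), which is below 1. A crude constant is enough:
    only the order in the mesh matters later. *)
Lemma normal_prob_ball (x : R) : 0 <= x ->
  (gamma `[(- x)%R, x]%classic <= (2 * x)%:E)%E.
Proof.
move=> x0; rewrite /normal_prob.
apply: (@le_trans _ _ (\int[lebesgue_measure]_(z in `[(- x)%R, x]) (cst 1%E z))%E).
  apply: ge0_le_integral => //=.
  - by move=> z _; rewrite lee_fin normal_pdf_ge0.
  - apply/measurable_EFinP; apply: measurable_funTS; exact: measurable_normal_pdf.
  - move=> z _; rewrite lee_fin (le_trans (normal_pdf_ub _ _ _)) ?oner_neq0//.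
    rewrite /normal_peak invf_le1 ?sqrtr_gt0; last first.
      by rewrite expr1n mul1r mulrn_wgt0// pi_gt0.
    rewrite -{1}sqrtr1 ler_wsqrtr// expr1n mul1r.
    have := pi_ge2 R; rewrite mulr2n; lra.
rewrite integral_cst//= mul1e lebesgue_measure_itv/= lte_fin.
by case: ifPn => _; rewrite -?EFinD lee_fin; lra.
Qed.

(** The two constraints force |Y| <= 2 e / |b|, so the event lies in a rectangle; its sides
    contribute 2 e and 4 e / |b|, whence the 8. *)
Lemma gauss_pair_small_ball (X Y : T -> R) c b e : gauss_pair P X Y ->
  c ^+ 2 + b ^+ 2 = 1 -> b != 0 -> 0 <= e ->
  (P [set w | (`|X w| <= e)%R /\ (`|c * X w + b * Y w| <= e)%R] <=
   (8 * e ^+ 2 / `|b|)%R%:E)%E.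
Proof.
move=> [mX mY XY] cb b0 e0; have b0' : 0 < `|b| by rewrite normr_gt0.
have e1 : 0 <= 2 * e / `|b| by rewrite divr_ge0// mulr_ge0.
have c1 : `|c| <= 1.
  by rewrite -(ler_pXn2r (n := 2)) ?nnegrE// -normrX expr1n
    ger0_norm ?sqr_ge0// -cb lerDl sqr_ge0.
have mB : measurable (`[- e, e]%classic `*` `[- (2 * e / `|b|), 2 * e / `|b|]%classic : set (R * R)).
  exact: measurableX.
have mball (Z : T -> R) : measurable_fun setT Z -> measurable [set w | `|Z w| <= e].
  move=> mZ; rewrite (_ : mkset _ = Z @^-1` `[- e, e]%classic).
    by rewrite -[X in measurable X]setTI; exact: mZ.
  by apply/seteqP; split => w/=; rewrite in_itv/= ler_norml.
have mX1 := mball _ mX.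
have mX2 : measurable [set w | `|c * X w + b * Y w| <= e].
  by apply: mball; apply: measurable_funD; apply: measurable_funM.
apply: (@le_trans _ _ (P ((fun w => (X w, Y w)) @^-1`
   (`[- e, e]%classic `*` `[- (2 * e / `|b|), 2 * e / `|b|]%classic)))).
  apply: le_measure; rewrite ?inE.
  - exact: measurableI.
  - rewrite -[X in measurable X]setTI.
    suff : measurable_fun setT (fun w => (X w, Y w)) by exact.
    by apply/measurable_fun_pairP; split.
  move=> w /= [Xe cXe]; split => /=; rewrite in_itv/= -ler_norml//.
  rewrite ler_pdivlMr// -normrM mulrC.
  rewrite (_ : b * Y w = (c * X w + b * Y w) - c * X w); last by ring.
  rewrite (le_trans (ler_normB _ _))// mulr2n mulrDl mul1r lerD//.
  by rewrite normrM -[leRHS]mul1r ler_pM.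
rewrite XY// normal_prob_prodX//.
apply: (@le_trans _ _ ((2 * e)%:E * (2 * (2 * e / `|b|))%:E)%E).
  by apply: lee_pmul => //; exact: normal_prob_ball.
by rewrite -EFinM lee_fin le_eqVlt; apply/orP; left; apply/eqP; field; rewrite gt_eqF.
Qed.

End PairEstimates.
End Sheppard.

(** * Zeros and sign changes on a grid *)

Section CircleParametrization.
Context {R : realType}.

Lemma circle_point_inj (s t : R) : 0 <= s < 2 * pi -> 0 <= t < 2 * pi ->
  circle_point s = circle_point t -> s = t.
Proof.
wlog st : s t / s <= t => [H s2 t2 e|].
  by have /orP[st|ts] := le_total s t; [exact: H|rewrite (H t s)].
move=> /andP[s0 s2] /andP[t0 t2] [ec es].
have cu : cos (t - s) = 1 by rewrite cosB ec es -!expr2 cos2Dsin2.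
have su : sin (t - s) = 0 by rewrite sinB ec es; ring.
apply/eqP; rewrite eq_sym -subr_eq0; apply/negPn/negP => u0.
have {}u0 : 0 < t - s by rewrite lt_neqAle eq_sym u0 subr_ge0.
have p0 := pi_gt0 R.
have [up|up|up] := ltgtP (t - s) pi.
- by have := sin_gt0_pi (x := t - s); rewrite u0 up su ltxx => /(_ isT).
- have : 0 < sin (t - s - pi) by apply: sin_gt0_pi; apply/andP; split; lra.
  by rewrite sinB su cospi sinpi; lra.
- by move: cu; rewrite up cospi; lra.
Qed.

Lemma circle_point_surj (z : R[i]) : unit_circle z ->
  exists2 t : R, 0 <= t < 2 * pi & z = circle_point t.
Proof.
case: z => x y; rewrite /unit_circle/= normc_def/= => -[e].
have {}e : x ^+ 2 + y ^+ 2 = 1.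
  have := congr1 (fun u => u ^+ 2) e.
  by rewrite sqr_sqrtr ?expr1n// addr_ge0// sqr_ge0.
have x1 : -1 <= x <= 1.
  by rewrite -ler_norml -(ler_pXn2r (n := 2)) ?nnegrE// -normrX expr1n
    ger0_norm ?sqr_ge0// -e lerDl sqr_ge0.
have p0 := pi_gt0 R; have a0 := acos_ge0 x1; have a1 := acos_lepi x1.
have cx : cos (acos x) = x by rewrite acosK.
have sx : sin (acos x) = `|y|.
  by rewrite sin_acos// -sqrtr_sqr; congr Num.sqrt; rewrite -e; ring.
have [y0|y0] := leP 0 y.
  exists (acos x); first by apply/andP; split; lra.
  by rewrite /circle_point cx sx ger0_norm.
have x_lt1 : x < 1.
  rewrite lt_neqAle (andP x1).2 andbT; apply/eqP => xE.
  by move: e; rewrite xE; nra.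
have a_gt0 : 0 < acos x by apply: acos_gt0; rewrite (andP x1).1.
exists (2 * pi - acos x); first by apply/andP; split; lra.
have pp : 2 * pi = pi *+ 2 :> R by rewrite mulr2n; ring.
rewrite /circle_point cosB sinB pp cos2pi sin2pi cx sx ltr0_norm//.
by congr (_ +i* _)%C; ring.
Qed.

(** The index [n] stands for [n.+1] cells, so the step is defined for every [n]; the last node is
    [2 * pi], the same point of the circle as the first. *)
Definition grid (n j : nat) : R := (2 * pi) * (j%:R / n.+1%:R).

Lemma grid0 n : grid n 0 = 0.
Proof. by rewrite /grid mul0r mulr0. Qed.

Lemma gridS n j : grid n j.+1 = grid n j + 2 * pi / n.+1%:R.
Proof. by rewrite /grid -natr1; ring. Qed.

Lemma grid_mono n i j : (i <= j)%N -> grid n i <= grid n j.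
Proof.
move=> ij; rewrite /grid ler_wpM2l ?mulr_ge0 ?pi_ge0//.
by rewrite ler_wpM2r ?invr_ge0// ler_nat.
Qed.

Lemma grid_bounds n j : (j <= n.+1)%N -> 0 <= grid n j <= 2 * pi.
Proof.
move=> jn; rewrite -{1}(grid0 n) grid_mono//= /grid.
rewrite -[leRHS]mulr1 ler_wpM2l ?mulr_ge0 ?pi_ge0//.
by rewrite ler_pdivrMr ?ltr0n// mul1r ler_nat.
Qed.

Lemma grid_bracket n (t : R) : 0 <= t < 2 * pi ->
  exists2 j : 'I_n.+1, grid n j <= t & t < grid n j.+1.
Proof.
move=> /andP[t0 t2].
have p0 : 0 < 2 * pi :> R by rewrite mulr_gt0 ?pi_gt0.
have N0 : 0 < n.+1%:R :> R by rewrite ltr0n.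
have q0 : 0 <= t / (2 * pi) * n.+1%:R by rewrite mulr_ge0// divr_ge0// ltW.
have /andP[jl ju] := Num.Theory.truncn_itv q0.
set j := Num.truncn _ in jl ju.
have jn : (j < n.+1)%N.
  rewrite -(ltr_nat R) (le_lt_trans jl)// -[ltRHS]mul1r ltr_pM2r//.
  by rewrite ltr_pdivrMr// mul1r.
exists (Ordinal jn); rewrite /grid/=.
- by rewrite mulrC -ler_pdivlMr// ler_pdivrMr.
- by rewrite mulrC -ltr_pdivrMr// ltr_pdivlMr.
Qed.

Definition sign_changes (f : R -> R) (n : nat) : nat :=
  #|[pred j : 'I_n.+1 | f (grid n j) * f (grid n j.+1) < 0]|.

Definition circle_zeros (f : R -> R) : set R[i] :=
  [set circle_point t | t in [set t : R | 0 <= t < 2 * pi /\ f t = 0]].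

Lemma counting_ge (K : choiceType) (A : set K) (s : seq K) : uniq s ->
  (forall x, x \in s -> A x) -> ((size s)%:R%:E <= counting A :> \bar R)%E.
Proof.
move=> us sA; rewrite /counting; case: asboolP => [fA|_]; last exact: leey.
rewrite lee_fin ler_nat; apply: uniq_leq_size => // x /sA Ax.
by rewrite in_fset_set// inE.
Qed.

(** A zero lies strictly inside each cell with a sign change, since the product of the end values is
    nonzero. Interiors of distinct cells are disjoint and contained in one period, so the zeros give
    distinct points of the circle. *)
Lemma sign_changes_le (f : R -> R) n : continuous f ->
  ((sign_changes f n)%:R%:E <= counting (circle_zeros f) :> \bar R)%E.
Proof.
move=> cf; rewrite /sign_changes cardE.
have ex (j : 'I_n.+1) : exists t : R, f (grid n j) * f (grid n j.+1) < 0 ->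
    [/\ grid n j < t, t < grid n j.+1 & f t = 0].
  have [sg|sg] := boolP (f (grid n j) * f (grid n j.+1) < 0); last by exists 0.
  have ab : grid n j <= grid n j.+1 by exact: grid_mono.
  have : Num.min (f (grid n j)) (f (grid n j.+1)) <= 0 <=
      Num.max (f (grid n j)) (f (grid n j.+1)).
    move: sg; rewrite mulr_lt0 => /and3P[_ _].
    by have [a0|a0] := ltP (f (grid n j)) 0; have [b0|b0] := ltP (f (grid n j.+1)) 0;
      rewrite //= => _; rewrite ge_min le_max ?(ltW a0) ?(ltW b0) ?a0 ?b0 ?orbT.
  move=> /(IVT ab)[]; first exact: continuous_subspaceT.
  move=> t; rewrite in_itv/= => /andP[t1 t2] ft; exists t => _; split => //.
  - by rewrite lt_neqAle t1 andbT; apply: contraTneq sg => ->; rewrite ft mul0r ltxx.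
  - by rewrite lt_neqAle t2 andbT; apply: contraTneq sg => <-; rewrite ft mulr0 ltxx.
have [g gP] := choice ex.
rewrite -(size_map (fun j => circle_point (g j))).
have gI j : f (grid n j) * f (grid n j.+1) < 0 -> forall jn : (j < n.+1)%N,
    0 <= g (Ordinal jn) < 2 * pi.
  move=> sg jn; have [g1 g2 _] := gP (Ordinal jn) sg.
  have /andP[b1 _] := grid_bounds (ltnW jn).
  have /andP[_ b2] := grid_bounds jn.
  by rewrite (le_trans b1 (ltW g1)) (lt_le_trans g2 b2).
apply: counting_ge.
  rewrite map_inj_in_uniq ?enum_uniq// => -[i iP] [j jP].
  rewrite !mem_enum !inE /= => si sj /(circle_point_inj (gI _ si iP) (gI _ sj jP)) e.
  have [i1 i2 _] := gP (Ordinal iP) si; have [j1 j2 _] := gP (Ordinal jP) sj.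
  apply: val_inj => /=; apply/eqP; rewrite eqn_leq; apply/andP; split; rewrite leqNgt.
  - apply/negP => ji; have := grid_mono n ji; rewrite leNgt => /negP; apply.
    by rewrite (lt_trans i1)// e.
  - apply/negP => ij; have := grid_mono n ij; rewrite leNgt => /negP; apply.
    by rewrite (lt_trans j1)// -e.
move=> _ /mapP[[j jP] +] ->; rewrite mem_enum inE /= => sj.
exists (g (Ordinal jP)) => //; split; first exact: gI.
by have [] := gP (Ordinal jP) sj.
Qed.

(* First order expansion with a uniform quadratic remainder: this is the only
   form in which differentiability is used. *)
Definition expansion (f df : R -> R) (M : R) :=
  forall x z, `|f x - f z - df z * (x - z)| <= M * (x - z) ^+ 2.

Lemma simple_zero_sign (f df : R -> R) M z : 0 < M -> expansion f df M ->
  f z = 0 -> df z != 0 ->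
  (* Up to distance [|df z| / M] the linear term dominates the quadratic remainder. *)
  exists2 e, 0 < e & forall x, x != z -> `|x - z| < e -> 0 < f x * ((x - z) * df z).
Proof.
move=> M0 fM fz dz; exists (`|df z| / M).
  by rewrite divr_gt0// normr_gt0.
move=> x xz; rewrite ltr_pdivlMr// => xe.
have := fM x z; rewrite fz subr0 => H.
have u0 : 0 < `|x - z| by rewrite normr_gt0 subr_eq0.
set u := x - z in xe u0 H *; set D := df z in dz xe H *.
have : `|f x - D * u| < `|D * u|.
  rewrite (le_lt_trans H)// -real_normK ?num_real// expr2 mulrA normrM ltr_pM2r//.
  by rewrite mulrC.
rewrite [u * D]mulrC; set v := D * u => Hv.
have v0 : v != 0 by rewrite -normr_eq0 gt_eqF// (le_lt_trans _ Hv).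
have [vn|vp|v00] := ltgtP v 0; last by rewrite v00 eqxx in v0.
- by move: Hv; rewrite (ltr0_norm vn) ltr_norml => /andP[? ?]; rewrite nmulr_lgt0//; lra.
- by move: Hv; rewrite (gtr0_norm vp) ltr_norml => /andP[? ?]; rewrite pmulr_lgt0//; lra.
Qed.

(** Once the mesh is below the radius at which each listed zero governs the sign, its cell carries a
    sign change. Two of these zeros cannot share a cell, since [f] would be nonzero at one of them
    by the sign rule at the other. *)
Lemma le_sign_changes (f df : R -> R) M (s : seq R) : 0 < M -> expansion f df M ->
  uniq s -> (forall t, t \in s -> [/\ 0 <= t < 2 * pi, f t = 0 & df t != 0]) ->
  (forall n j, (j <= n.+1)%N -> f (grid n j) != 0) ->
  \forall n \near \oo, (size s <= sign_changes f n)%N.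
Proof.
move=> M0 fM us sP gf.
have [e e0 eP] : exists2 e, 0 < e & forall t, t \in s -> forall x, x != t ->
    `|x - t| < e -> 0 < f x * ((x - t) * df t).
  elim: s us sP => [|t s IH] /=; first by exists 1.
  move=> /andP[_ us] sP.
  have [|e e0 eP] := IH us; first by move=> x xs; apply: sP; rewrite inE xs orbT.
  have [_ ft dt] := sP _ (mem_head _ _).
  have [e' e'0 e'P] := simple_zero_sign M0 fM ft dt.
  exists (Num.min e e'); first by rewrite lt_min e0.
  by move=> x; rewrite inE => /predU1P[->|xs] y yx; rewrite lt_min => /andP[? ?];
    [exact: e'P|exact: eP].
near=> n.
have hn : 2 * pi / n.+1%:R < e.
  rewrite ltr_pdivrMr ?ltr0n// [e * _]mulrC -ltr_pdivrMr//.
  near: n; exists (Num.truncn (2 * pi / e)) => // n /= Nn.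
  by rewrite (lt_le_trans (Num.Theory.truncnS_gt _))// ler_nat ltnS.
have ex (t : R) : exists j : 'I_n.+1, t \in s -> grid n j < t < grid n j.+1.
  have [ts|_] := boolP (t \in s); last by exists ord0.
  have [t2 ft _] := sP _ ts; have [j j1 j2] := grid_bracket n t2.
  exists j => _; rewrite j2 andbT lt_neqAle j1 andbT.
  by apply: contraNneq (gf n j (ltnW (ltn_ord j))) => ->; rewrite ft.
have [g gP] := choice ex.
rewrite -(size_map g) /sign_changes cardE; apply: uniq_leq_size.
  rewrite map_inj_in_uniq// => t u ts us' gtu; apply/eqP; apply: contraT => tu.
  have /andP[t1 t2] := gP _ ts; have /andP[u1 u2] := gP _ us'.
  rewrite gtu gridS in t2; rewrite gtu in t1; rewrite gridS in u2.
  have : `|t - u| < e.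
    by rewrite (lt_trans _ hn)// ltr_norml; apply/andP; split;
      move: t1 t2 u1 u2; set h := 2 * pi / _; lra.
  move/(eP _ us' _ tu); have [_ -> _] := sP _ ts.
  by rewrite mul0r ltxx.
move=> _ /mapP[t ts ->]; rewrite mem_enum inE.
have /andP[t1 t2] := gP _ ts; have t2' := t2; rewrite gridS in t2'.
have dl : `|grid n (g t) - t| < e.
  by rewrite (lt_trans _ hn)// ltr_norml; apply/andP; split;
    move: t1 t2'; set h := 2 * pi / _; lra.
have dr : `|grid n (g t).+1 - t| < e.
  by rewrite (lt_trans _ hn)// ltr_norml; apply/andP; split;
    move: t1 t2 t2'; rewrite gridS; set h := 2 * pi / _; lra.
have := eP _ ts _ (negbT (gt_eqF t2)) dr; have := eP _ ts _ (negbT (lt_eqF t1)) dl.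
rewrite mulrCA nmulr_rgt0 ?subr_lt0// => l0.
rewrite mulrCA pmulr_rgt0 ?subr_gt0// => r0.
rewrite /= ltNge; apply/negP => H.
have : f (grid n (g t)) * f (grid n (g t).+1) * (df t * df t) < 0.
  by rewrite mulrACA nmulr_rlt0.
by rewrite ltNge mulr_ge0// -expr2 sqr_ge0.
Unshelve. all: by end_near.
Qed.

(** Each finite set of zeros bounds the liminf from below by its size. The zero set may a priori be
    infinite; its finite subsets are then arbitrarily large and the liminf is [+oo]. *)
Lemma circle_zeros_le (f df : R -> R) M : 0 < M -> expansion f df M ->
  (forall t, 0 <= t < 2 * pi -> f t = 0 -> df t != 0) ->
  (forall n j, (j <= n.+1)%N -> f (grid n j) != 0) ->
  (counting (circle_zeros f) <= limn_einf (fun n => (sign_changes f n)%:R%:E) :> \bar R)%E.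
Proof.
move=> M0 fM fd gf.
have key (s : seq R[i]) : uniq s -> (forall z, z \in s -> circle_zeros f z) ->
    ((size s)%:R%:E <= limn_einf (fun n => (sign_changes f n)%:R%:E : \bar R))%E.
  move=> us sz.
  have ex (z : R[i]) : exists t : R, z \in s ->
      [/\ 0 <= t < 2 * pi, f t = 0 & circle_point t = z].
    have [/sz[t [t2 ft] <-]|_] := boolP (z \in s); last by exists 0.
    by exists t.
  have [g gP] := choice ex.
  have : \forall n \near \oo, (size (map g s) <= sign_changes f n)%N.
    apply: (le_sign_changes M0 fM) => //.
      rewrite map_inj_in_uniq// => x y /gP[_ _ xE] /gP[_ _ yE] e.
      by rewrite -xE -yE e.
    by move=> _ /mapP[z /gP[t2 ft _] ->]; split => //; exact: fd.
  rewrite size_map => -[N _ HN].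
  rewrite limn_einf_lim; apply: lime_ge; first exact: is_cvg_einfs.
  exists N => // n Nn; apply: le_ereal_inf_tmp => _ [m /= nm <-].
  by rewrite lee_fin ler_nat; apply: HN => /=; exact: leq_trans Nn nm.
rewrite {1}/counting; case: asboolP => [fin|inf].
  by apply: key; [exact: fset_uniq|move=> z; rewrite in_fset_set// inE].
rewrite leye_eq; apply/eqP/eqyP => A A0.
have /(infinite_set_fset (Num.truncn A).+1)[B BZ cB] : infinite_set (circle_zeros f).
  exact: inf.
apply: (@le_trans _ _ (#|` B|%:R%:E)).
  rewrite lee_fin (le_trans (ltW (Num.Theory.truncnS_gt A)))// ler_nat//.
by apply: key => //; exact: fset_uniq.
Qed.

(** A double zero leaves only the quadratic remainder at the two nodes around it. This turns a
    condition on uncountably many [t] into one on finitely many pairs of grid values. *)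
Lemma double_zero_grid (f df : R -> R) M t n : 0 <= M -> expansion f df M ->
  0 <= t < 2 * pi -> f t = 0 -> df t = 0 ->
  exists j : 'I_n.+1, `|f (grid n j)| <= M * (2 * pi / n.+1%:R) ^+ 2 /\
    `|f (grid n j.+1)| <= M * (2 * pi / n.+1%:R) ^+ 2.
Proof.
move=> M0 fM t2 ft dt; have [j j1 j2] := grid_bracket n t2.
have j3 := j2; rewrite gridS in j3.
have h0 : 0 <= 2 * pi / n.+1%:R :> R by rewrite divr_ge0// mulr_ge0// pi_ge0.
have bd x : `|x - t| <= 2 * pi / n.+1%:R -> `|f x| <= M * (2 * pi / n.+1%:R) ^+ 2.
  move=> xt; have := fM x t; rewrite ft dt mul0r !subr0 => /le_trans; apply.
  by rewrite ler_wpM2l// -real_normK ?num_real// ler_pXn2r ?nnegrE.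
exists j; split; apply: bd; rewrite ?gridS; set h := 2 * pi / _ in h0 j3 *.
- by rewrite ler_norml; apply/andP; split; lra.
- by rewrite ler_norml; apply/andP; split; lra.
Qed.

End CircleParametrization.

(** * The space of trigonometric polynomials *)

Section TrigSpace.
Context {R : realType}.
Implicit Types (f g : R -> R) (L : {fset int}).

Lemma continuous_cos_affine (a p : R) : continuous (fun t : R => cos (a * t + p)).
Proof.
move=> x; apply: (@continuous_comp _ _ _ (fun t : R => a * t + p) cos).
  by apply: cvgD; [apply: cvgM; [exact: cvg_cst|exact: cvg_id]|exact: cvg_cst].
exact: continuous_cos.
Qed.

Lemma continuous_sin_affine (a p : R) : continuous (fun t : R => sin (a * t + p)).
Proof.
move=> x; apply: (@continuous_comp _ _ _ (fun t : R => a * t + p) sin).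
  by apply: cvgD; [apply: cvgM; [exact: cvg_cst|exact: cvg_id]|exact: cvg_cst].
exact: continuous_sin.
Qed.

Lemma continuous_add_fun f g : continuous f -> continuous g ->
  continuous (fun t => f t + g t).
Proof. by move=> cf cg x; apply: cvgD; [exact: cf|exact: cg]. Qed.

Lemma continuous_sum_fun (I : Type) (r : seq I) (F : I -> R -> R) :
  (forall i, continuous (F i)) -> continuous (fun t => \sum_(i <- r) F i t).
Proof.
move=> cF; elim: r => [|i r IH].
  by under eq_fun do rewrite big_nil; move=> x; exact: cvg_cst.
under eq_fun do rewrite big_cons; move=> x.
by apply: cvgD; [exact: cF|exact: IH].
Qed.

Lemma continuous_scale_fun (c : R) f : continuous f -> continuous (fun t => c * f t).
Proof. by move=> cf x; apply: cvgM; [exact: cvg_cst|exact: cf]. Qed.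

Lemma continuous_mul_fun f g : continuous f -> continuous g ->
  continuous (fun t => f t * g t).
Proof. by move=> cf cg x; apply: cvgM; [exact: cf|exact: cg]. Qed.

Lemma continuous_trig L f : Trig L f -> continuous f.
Proof.
move=> [al [be fE]]; rewrite (_ : f = fun t => \sum_(k <- L)
   (al k * cos (k%:~R * t) + be k * sin (k%:~R * t))); last exact/funext.
have cc k : continuous (fun t : R => cos (k%:~R * t)).
  rewrite (_ : (fun t => _) = fun t => cos (k%:~R * t + 0)).
    exact: continuous_cos_affine.
  by apply/funext => t; rewrite addr0.
have cs k : continuous (fun t : R => sin (k%:~R * t)).
  rewrite (_ : (fun t => _) = fun t => sin (k%:~R * t + 0)).
    exact: continuous_sin_affine.
  by apply/funext => t; rewrite addr0.
by apply: continuous_sum_fun => k; apply: continuous_add_fun; exact: continuous_scale_fun.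
Qed.

Definition circle_integral f : R := \int[lebesgue_measure]_(t in `[0, 2 * pi]) f t.

Lemma continuous_integrable_circle f : continuous f ->
  (@lebesgue_measure R).-integrable `[0, 2 * pi] (EFin \o f).
Proof.
move=> cf; apply: continuous_compact_integrable; first exact: segment_compact.
exact: continuous_subspaceT.
Qed.

Lemma circle_integralD f g : continuous f -> continuous g ->
  circle_integral (fun t => f t + g t) = circle_integral f + circle_integral g.
Proof. by move=> cf cg; apply: RintegralD => //; exact: continuous_integrable_circle. Qed.

Lemma circle_integralZ c f : continuous f ->
  circle_integral (fun t => c * f t) = c * circle_integral f.
Proof. by move=> cf; apply: RintegralZl => //; exact: continuous_integrable_circle. Qed.

Lemma circle_integral_sum (I : Type) (r : seq I) (F : I -> R -> R) :
  (forall i, continuous (F i)) ->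
  circle_integral (fun t => \sum_(i <- r) F i t) = \sum_(i <- r) circle_integral (F i).
Proof.
move=> cF; elim: r => [|i r IH].
  rewrite big_nil /circle_integral; under eq_Rintegral do rewrite big_nil.
  by rewrite Rintegral_cst// mul0r.
rewrite big_cons -IH -circle_integralD//; last exact: continuous_sum_fun.
by apply: eq_Rintegral => t _; rewrite big_cons.
Qed.

Lemma sin_int_period (m : int) (x : R) : sin (m%:~R * (2 * pi) + x) = sin x.
Proof.
have pp : 2 * pi = pi *+ 2 :> R by rewrite mulr2n; ring.
case: m => n.
  rewrite [X in sin X](_ : _ = x + (pi *+ 2) *+ n) ?(periodicn (@sinD2pi R))//.
  by rewrite pp addrC -[in RHS]mulr_natl.
rewrite -[in RHS](subrK ((pi *+ 2) *+ n.+1) x) (periodicn (@sinD2pi R)); congr sin.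
by rewrite pp NegzE mulrNz mulNr addrC -[in RHS]mulr_natl.
Qed.

(** The phase [p] lets this one formula serve the sines too, as cosines of phase - pi / 2. *)
Lemma circle_integral_cos (m : int) (p : R) :
  circle_integral (fun t => cos (m%:~R * t + p)) = 2 * pi * ((m == 0)%:R * cos p).
Proof.
have p0 : 0 < 2 * pi :> R by rewrite mulr_gt0 ?pi_gt0.
have [->|m0] := eqVneq m 0.
  rewrite /circle_integral; under eq_Rintegral do rewrite mul0r add0r.
  rewrite Rintegral_cst//= mul1r mulrC lebesgue_measure_itv/= lte_fin p0/= subr0//.
have mR : m%:~R != 0 :> R by rewrite intr_eq0.
pose F (t : R) : R := m%:~R^-1 * sin (m%:~R * t + p).
have dF (t : R) : is_derive t 1 F (cos (m%:~R * t + p)).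
  apply: is_derive_eq; rewrite /GRing.scale/=.
  by rewrite ?mulr1 ?addr0 ?mul0r ?mulr0; field.
have cF : continuous F.
  by apply: continuous_scale_fun; exact: continuous_sin_affine.
rewrite mul0r mulr0 /circle_integral /Rintegral.
rewrite (@continuous_FTC2 R _ F)//.
- by rewrite /F /= sin_int_period mulr0 add0r subrr.
- by apply: continuous_subspaceT; exact: continuous_cos_affine.
- split; first by move=> t _; exact: (@ex_derive _ _ _ _ _ _ _ (dF t)).
  + by apply: cvg_at_right_filter; exact: cF.
  + by apply: cvg_at_left_filter; exact: cF.
- by move=> t _; rewrite derive1E; exact: (@derive_val _ _ _ _ _ _ _ (dF t)).
Qed.

Lemma cosM (x y : R) : cos x * cos y = 2^-1 * (cos (x + y) + cos (x - y)).
Proof. by rewrite cosD cosB; field. Qed.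

Lemma circle_integral_cos2 (m k : int) (p q : R) :
  circle_integral (fun t => cos (m%:~R * t + p) * cos (k%:~R * t + q)) =
  pi * ((m == - k)%:R * cos (p + q) + (m == k)%:R * cos (p - q)).
Proof.
transitivity (circle_integral (fun t =>
  2^-1 * (cos ((m + k)%:~R * t + (p + q)) + cos ((m - k)%:~R * t + (p - q))))).
  apply: eq_Rintegral => t _.
  rewrite (_ : (m + k)%:~R * t + (p + q) = (m%:~R * t + p) + (k%:~R * t + q)); last by rewrite intrD; ring.
  rewrite (_ : (m - k)%:~R * t + (p - q) = (m%:~R * t + p) - (k%:~R * t + q)); last by rewrite intrB; ring.
  exact: cosM.
have cD : continuous (fun t : R => cos ((m + k)%:~R * t + (p + q)) + cos ((m - k)%:~R * t + (p - q))).
  by apply: continuous_add_fun; exact: continuous_cos_affine.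
rewrite circle_integralZ// circle_integralD; try exact: continuous_cos_affine.
by rewrite !circle_integral_cos addr_eq0 subr_eq0; field.
Qed.

Lemma sum_delta (K : nzRingType) L (j : int) (F : int -> K) : j \in L ->
  \sum_(k <- L) (k == j)%:R * F k = F j.
Proof.
move=> jL; rewrite (bigD1_seq j jL (fset_uniq L))/= eqxx mul1r big1 ?addr0// => k /negbTE->.
by rewrite mul0r.
Qed.

(** * The reproducing kernel *)

Definition dirichlet_kernel L (h : R) : R :=
  (2 * pi)^-1 * \sum_(k <- L) cos (k%:~R * h).

Lemma circle_integral_trig_cos L (al be : int -> R) (k : int) (q : R) :
  circle_integral (fun t => (\sum_(j <- L) (al j * cos (j%:~R * t) +
    be j * sin (j%:~R * t))) * cos (k%:~R * t + q)) =
  \sum_(j <- L) (al j * (pi * ((j == - k)%:R * cos q + (j == k)%:R * cos q)) +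
    be j * (pi * ((j == - k)%:R * sin q - (j == k)%:R * sin q))).
Proof.
transitivity (circle_integral (fun t => \sum_(j <- L)
   (al j * (cos (j%:~R * t + 0) * cos (k%:~R * t + q)) +
    be j * (cos (j%:~R * t + - (pi / 2)) * cos (k%:~R * t + q))))).
  apply: eq_Rintegral => t _; rewrite mulr_suml; apply: eq_bigr => j _.
  by rewrite addr0 cosBpihalf; ring.
have cc (j : int) (p : R) : continuous (fun t : R => cos (j%:~R * t + p) * cos (k%:~R * t + q)).
  by apply: continuous_mul_fun; exact: continuous_cos_affine.
rewrite circle_integral_sum; last first.
  move=> j; apply: continuous_add_fun; apply: continuous_scale_fun; exact: cc.
apply: eq_bigr => j _.
rewrite circle_integralD; try (apply: continuous_scale_fun; exact: cc).
rewrite !circle_integralZ; try exact: cc.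
rewrite !circle_integral_cos2 add0r sub0r cosN.
rewrite [- _ + q]addrC cosBpihalf -opprD cosN [pi / 2 + q]addrC cosDpihalf.
by rewrite mulrN.
Qed.

(** Each frequency [j] of [f] is met by both deltas, at [k = j] and at [k = - j], the latter being
    in [L] by symmetry. The two contributions are equal, for cosines and sines alike, and their sum
    cancels the normalisation [2 * pi]. *)
Lemma dirichlet_reproducing L f s : (forall m : int, m \in L -> - m \in L) ->
  Trig L f -> trig_inner f (fun t => dirichlet_kernel L (s - t)) = f s.
Proof.
move=> Lsym fT; have cf := continuous_trig fT.
have [al [be fE]] := fT.
have fI (k : int) (q : R) : circle_integral (fun t => f t * cos (k%:~R * t + q)) =
    \sum_(j <- L) (al j * (pi * ((j == - k)%:R * cos q + (j == k)%:R * cos q)) +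
    be j * (pi * ((j == - k)%:R * sin q - (j == k)%:R * sin q))).
  rewrite -circle_integral_trig_cos; congr circle_integral.
  by apply/funext => t; rewrite fE.
have p0 : pi != 0 :> R by rewrite gt_eqF ?pi_gt0.
transitivity (circle_integral (fun t => (2 * pi)^-1 * \sum_(k <- L)
    f t * cos ((- k)%:~R * t + k%:~R * s))).
  apply: eq_Rintegral => t _; rewrite /dirichlet_kernel mulrCA; congr (_ * _).
  rewrite mulr_sumr; apply: eq_bigr => k _; congr (_ * cos _).
  by rewrite intrN; ring.
have cc (k : int) : continuous (fun t : R => f t * cos ((- k)%:~R * t + k%:~R * s)).
  by apply: continuous_mul_fun => //; exact: continuous_cos_affine.
rewrite circle_integralZ; last exact: continuous_sum_fun.
rewrite circle_integral_sum//.
under eq_bigr do rewrite fI.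
rewrite exchange_big/= mulr_sumr fE; rewrite big_seq [RHS]big_seq.
apply: eq_bigr => j jL; rewrite big_split/= -!mulr_sumr.
have opE (k : int) : (j == - - k) = (k == j) by rewrite opprK eq_sym.
have opE' (k : int) : (j == - k) = (k == - j) by rewrite -eqr_oppLR eq_sym.
under eq_bigr do rewrite opE opE'.
under [X in _ + _ * (_ * X)]eq_bigr do rewrite opE opE'.
rewrite big_split sumrB/= !sum_delta ?Lsym// intrN mulNr cosN sinN.
move: (al j) (be j) (cos _) (sin _) => A B C S.
rewrite (_ : A * _ + _ = 2 * pi * (A * C + B * S)); last by ring.
by rewrite mulKf// mulf_neq0// pnatr_eq0.
Qed.

Lemma dirichlet_trig L s : Trig L (fun t => dirichlet_kernel L (s - t)).
Proof.
exists (fun k => (2 * pi)^-1 * cos (k%:~R * s)), (fun k => (2 * pi)^-1 * sin (k%:~R * s)).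
move=> t; rewrite /dirichlet_kernel mulr_sumr; apply: eq_bigr => k _.
by rewrite mulrBr cosB; ring.
Qed.

Lemma orthonormal_coordinates L n (e : 'I_n -> R -> R) g (c : 'I_n -> R) :
  trig_orthonormal_basis L e -> (forall t, g t = \sum_(i < n) c i * e i t) ->
  forall j, c j = trig_inner (e j) g.
Proof.
move=> [eT eO _] gE j.
have ce i : continuous (e i) by exact: continuous_trig (eT i).
transitivity (circle_integral (fun t => \sum_(i < n) c i * (e j t * e i t))); last first.
  by apply: eq_Rintegral => t _; rewrite gE mulr_sumr; apply: eq_bigr => i _; ring.
have cc i : continuous (fun t => e j t * e i t) by exact: continuous_mul_fun.
rewrite circle_integral_sum; last by move=> i; exact: continuous_scale_fun.
under eq_bigr do rewrite circle_integralZ// [circle_integral _]eO.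
by rewrite (bigD1 j)//= eqxx mulr1 big1 ?addr0// => i /negbTE; rewrite eq_sym => ->; rewrite mulr0.
Qed.

(** By the reproducing property, the coordinates of the kernel at [s] in the basis are the values
    [e i s]. So the covariance of the values of [F] does not depend on the basis. *)
Lemma orthonormal_kernel L n (e : 'I_n -> R -> R) s t :
  (forall m : int, m \in L -> - m \in L) -> trig_orthonormal_basis L e ->
  \sum_(i < n) e i s * e i t = dirichlet_kernel L (s - t).
Proof.
move=> Lsym eB; have [eT _ eS] := eB.
have [c cE] := eS _ (dirichlet_trig L s).
rewrite cE; apply: eq_bigr => i _; rewrite (orthonormal_coordinates eB cE).
by rewrite dirichlet_reproducing.
Qed.

(** * Quadratic remainders for trigonometric polynomials *)

Lemma normr_sin_le (v : R) : `|sin v| <= `|v|.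
Proof.
wlog v0 : v / 0 < v => [H|].
  have [vn|vp|->] := ltgtP v 0; last by rewrite sin0.
    by rewrite -normrN -sinN -[leRHS]normrN H// oppr_gt0.
  exact: H.
have [c _] := MVT v0 (fun y _ => is_derive_sin y)
  (continuous_subspaceT (@continuous_sin R)).
by rewrite sin0 !subr0 => ->; rewrite normrM ler_piMl// cos_max.
Qed.

(** The addition formulas reduce both bounds to |cos u - 1| <= u^2 and |sin u - u| <= u^2, whose sum
    gives the 2. The first comes from the half angle; the second from the mean value theorem for sin
    t - t and the linear bound |cos v - 1| <= |v|. *)
Lemma cos_expansion (z x : R) : `|cos x - cos z + sin z * (x - z)| <= 2 * (x - z) ^+ 2 /\
  `|sin x - sin z - cos z * (x - z)| <= 2 * (x - z) ^+ 2.
Proof.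
set u := x - z.
have sl := normr_sin_le.
have cE (v : R) : `|cos v - 1| = 2 * sin (v / 2) ^+ 2.
  rewrite (_ : cos v = cos ((v / 2) *+ 2)); last by congr cos; rewrite mulr2n; field.
  rewrite cos_mulr2n cos2sin2 (_ : _ - 1 = - (2 * sin (v / 2) ^+ 2)); last by ring.
  by rewrite normrN ger0_norm// mulr_ge0// sqr_ge0.
have half (v : R) : `|v / 2| = `|v| / 2 by rewrite normrM normfV (ger0_norm (ler0n _ 2)).
have c1 : `|cos u - 1| <= u ^+ 2.
  rewrite cE -real_normK ?num_real// -[leRHS]real_normK ?num_real//.
  have := sl (u / 2); rewrite half.
  have := normr_ge0 (sin (u / 2)); have := normr_ge0 u.
  by move: `|u| `|sin _| => a b a0 b0 ab; nra.
have c2 (v : R) : `|cos v - 1| <= `|v|.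
  rewrite cE -real_normK ?num_real//.
  have := sl (v / 2); rewrite half.
  have := normr_ge0 (sin (v / 2)); have := normr_ge0 v; have := sin_max (v / 2).
  by move: `|v| `|sin _| => a b b1 a0 b0 ab; nra.
have s1' (v : R) : `|sin v - v| <= v ^+ 2.
  wlog v0 : v / 0 < v => [H|].
    have [vn|vp|->] := ltgtP v 0; last by rewrite sin0 subrr normr0 expr0n.
      have := H (- v); rewrite oppr_gt0 sinN -opprD normrN sqrrN; exact.
    exact: H.
  have dg (y : R) : is_derive y 1 (fun t : R => sin t - t) (cos y - 1).
    by apply: is_deriveB.
  have cg : continuous (fun t : R => sin t - t).
    by move=> y; apply: cvgB; [exact: continuous_sin|exact: cvg_id].
  have [c] := MVT v0 (fun y _ => dg y) (continuous_subspaceT cg).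
  rewrite sin0 !subr0 in_itv/= => /andP[c0 cv] ->.
  rewrite normrM expr2 (gtr0_norm v0) ler_wpM2r ?(ltW v0)//.
  by rewrite (le_trans (c2 c))// gtr0_norm// ltW.
have s1 := s1' u; have xE : x = z + u by rewrite /u addrC subrK.
rewrite xE cosD sinD; split.
- rewrite (_ : cos z * cos u - sin z * sin u - cos z + sin z * u =
    cos z * (cos u - 1) - sin z * (sin u - u)); last by ring.
  rewrite (le_trans (ler_normB _ _))// !normrM mulr2n mulrDl mul1r lerD//;
    by rewrite -[leRHS]mul1r ler_pM// ?cos_max ?sin_max.
- rewrite (_ : sin z * cos u + cos z * sin u - sin z - cos z * u =
    sin z * (cos u - 1) + cos z * (sin u - u)); last by ring.
  rewrite (le_trans (ler_normD _ _))// !normrM mulr2n mulrDl mul1r lerD//;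
    by rewrite -[leRHS]mul1r ler_pM// ?cos_max ?sin_max.
Qed.

Lemma expansion_sum (I : Type) (r : seq I) (f df : I -> R -> R) (c M : I -> R) :
  (forall i, expansion (f i) (df i) (M i)) ->
  expansion (fun t => \sum_(i <- r) c i * f i t)
    (fun t => \sum_(i <- r) c i * df i t) (\sum_(i <- r) `|c i| * M i).
Proof.
move=> fM x z; rewrite mulr_suml -!sumrB mulr_suml.
rewrite (le_trans (ler_norm_sum _ _ _))//; apply: ler_sum => i _.
rewrite -mulrBr -!mulrA -mulrBr normrM ler_wpM2l//; exact: fM.
Qed.

Lemma expansionD f df M g dg N : expansion f df M -> expansion g dg N ->
  expansion (fun t => f t + g t) (fun t => df t + dg t) (M + N).
Proof.
move=> fM gN x z; rewrite [leRHS]mulrDl.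
apply: le_trans (lerD (fM x z) (gN x z)); apply: le_trans (ler_normD _ _).
by rewrite le_eqVlt; apply/orP; left; apply/eqP; congr `|_|; ring.
Qed.

Lemma expansion_scale f df M (a : R) : expansion f df M ->
  expansion (fun t => f (a * t)) (fun t => a * df (a * t)) (M * a ^+ 2).
Proof.
move=> fM x z.
rewrite (_ : M * a ^+ 2 * (x - z) ^+ 2 = M * (a * x - a * z) ^+ 2); last by ring.
rewrite (_ : a * df (a * z) * (x - z) = df (a * z) * (a * x - a * z)); last by ring.
exact: fM.
Qed.

Lemma trig_has_expansion L f : Trig L f ->
  exists df M, 0 <= M /\ expansion f df M.
Proof.
move=> [al [be fE]].
have eC : expansion (@cos R) (fun t => - sin t) 2.
  by move=> x z; have [+ _] := cos_expansion z x; rewrite mulNr opprK.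
have eS : expansion (@sin R) (@cos R) 2.
  by move=> x z; have [_] := cos_expansion z x.
have e1 := expansion_sum L al (fun k : int => expansion_scale k%:~R eC).
have e2 := expansion_sum L be (fun k : int => expansion_scale k%:~R eS).
have e12 := expansionD e1 e2.
exists (fun t => \sum_(i <- L) al i * (i%:~R * - sin (i%:~R * t)) +
  \sum_(i <- L) be i * (i%:~R * cos (i%:~R * t))); eexists; split; last first.
  move=> x z; rewrite !fE !big_split; exact: e12.
by apply: addr_ge0; apply: sumr_ge0 => k _; apply: mulr_ge0 => //; apply: mulr_ge0 => //; exact: sqr_ge0.
Qed.

End TrigSpace.

(** * Roots of Laurent polynomials *)

Section LaurentRoots.
Context {R : realType}.
Implicit Types (L : {fset int}) (a : int -> R[i]).

Lemma circle_point0 : circle_point (0 : R) = 1.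
Proof. by rewrite /circle_point cos0 sin0. Qed.

Lemma circle_pointD (s t : R) : circle_point (s + t) = circle_point s * circle_point t.
Proof.
by rewrite /circle_point cosD sinD; apply/eqP; rewrite eq_complex/= eqxx/=;
  apply/eqP; ring.
Qed.

Lemma circle_point_unit (t : R) : unit_circle (circle_point t).
Proof. by rewrite /unit_circle/= normc_def/= cos2Dsin2 sqrtr1. Qed.

Lemma circle_point_neq0 (t : R) : circle_point t != 0.
Proof. by rewrite -normr_eq0 circle_point_unit oner_eq0. Qed.

Lemma circle_pointX (t : R) (m : int) : circle_point t ^ m = circle_point (m%:~R * t).
Proof.
have nat_case n : circle_point t ^+ n = circle_point (n%:R * t).
  elim: n => [|n IH]; first by rewrite expr0 mul0r circle_point0.
  by rewrite exprS IH -circle_pointD -natr1; congr circle_point; ring.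
case: m => n; first by rewrite -exprnP nat_case.
rewrite NegzE -exprnN nat_case; apply: (mulfI (circle_point_neq0 (n.+1%:R * t))).
rewrite mulfV ?circle_point_neq0// -circle_pointD -circle_point0; congr circle_point.
by rewrite mulrNz; ring.
Qed.

Lemma Re_sum (I : Type) (r : seq I) (F : I -> R[i]) :
  complex.Re (\sum_(i <- r) F i) = \sum_(i <- r) complex.Re (F i).
Proof.
elim: r => [|i r IH]; first by rewrite !big_nil.
by rewrite !big_cons -IH; case: (F i) => x y; case: (\sum_(_ <- _) _).
Qed.

Lemma Im_sum (I : Type) (r : seq I) (F : I -> R[i]) :
  complex.Im (\sum_(i <- r) F i) = \sum_(i <- r) complex.Im (F i).
Proof.
elim: r => [|i r IH]; first by rewrite !big_nil.
by rewrite !big_cons -IH; case: (F i) => x y; case: (\sum_(_ <- _) _).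
Qed.

Lemma Re_laurent L a (t : R) : complex.Re (laurent L a (circle_point t)) =
  \sum_(m <- L) (complex.Re (a m) * cos (m%:~R * t) + - complex.Im (a m) * sin (m%:~R * t)).
Proof.
rewrite /laurent Re_sum; apply: eq_bigr => m _; rewrite circle_pointX.
by case: (a m) => x y /=; rewrite mulNr.
Qed.

Lemma Im_laurent L a (t : R) : complex.Im (laurent L a (circle_point t)) =
  \sum_(m <- L) (complex.Im (a m) * cos (m%:~R * t) + complex.Re (a m) * sin (m%:~R * t)).
Proof.
rewrite /laurent Im_sum; apply: eq_bigr => m _; rewrite circle_pointX.
by case: (a m) => x y /=; rewrite addrC.
Qed.

Lemma laurent_circle L a (t : R) : real_laurent L a ->
  laurent L a (circle_point t) = ((circle_restriction L a t)%:C)%C.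
Proof. by move=> /(_ _ (circle_point_unit t))/RRe_real. Qed.

Lemma real_rootsE L a : real_laurent L a ->
  real_roots L a = circle_zeros (circle_restriction L a).
Proof.
move=> ra; apply/seteqP; split => [z [/circle_point_surj[t t2 ->]]|_ [t [t2 ft] <-]].
  by rewrite laurent_circle// => -[ft]; exists t.
by split; [exact: circle_point_unit|rewrite laurent_circle// ft].
Qed.

(** The imaginary part vanishes on the circle; its integral against sin (k t), the cosine of phase -
    pi / 2, yields the first equality. The second makes [Re (a k)] a linear functional of the
    restriction, so that it can be shown to be almost surely nonzero. *)
Lemma fourier_cos_coefficient L a (k : int) : real_laurent L a -> k \in L -> - k \in L ->
  complex.Re (a k) = complex.Re (a (- k)) /\
  circle_integral (fun t => circle_restriction L a t * cos (k%:~R * t)) =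
    2 * pi * complex.Re (a k).
Proof.
move=> ra kL NkL; have p0 : pi != 0 :> R by rewrite gt_eqF ?pi_gt0.
have ReE : complex.Re (a k) = complex.Re (a (- k)).
  have := circle_integral_trig_cos L (fun m => complex.Im (a m))
    (fun m => complex.Re (a m)) k (- (pi / 2)).
  rewrite [LHS](_ : _ = 0); last first.
    rewrite /circle_integral; under eq_Rintegral.
      move=> t _; rewrite -Im_laurent laurent_circle// mul0r; over.
    by rewrite Rintegral_cst// mul0r.
  rewrite cosN cos_pihalf sinN sin_pihalf.
  rewrite (eq_bigr (fun j => pi * ((j == k)%:R * complex.Re (a j) -
    (j == - k)%:R * complex.Re (a j)))); last by move=> j _; ring.
  rewrite -mulr_sumr sumrB !sum_delta// => /esym/eqP.
  by rewrite mulf_eq0 (negbTE p0)/= subr_eq0 => /eqP.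
split=> //.
transitivity (circle_integral (fun t => (\sum_(m <- L)
  (complex.Re (a m) * cos (m%:~R * t) + - complex.Im (a m) * sin (m%:~R * t))) *
  cos (k%:~R * t + 0))).
  by apply: eq_Rintegral => t _; rewrite addr0 -Re_laurent.
rewrite circle_integral_trig_cos cos0 sin0.
rewrite (eq_bigr (fun j => pi * ((j == - k)%:R * complex.Re (a j) +
  (j == k)%:R * complex.Re (a j)))); last by move=> j _; ring.
by rewrite -mulr_sumr big_split/= !sum_delta// -ReE; ring.
Qed.

(** * Roots counted with multiplicity *)

Lemma mem_spectrum_degree L (m : int) : m \in L -> (absz m <= spectrum_degree L)%N.
Proof. by move=> mL; rewrite /spectrum_degree (big_rem m mL) leq_maxl. Qed.

Lemma bigmax_absz_mem (s : seq int) : s != [::] ->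
  exists2 m : int, m \in s & (\max_(m <- s) absz m)%N = absz m.
Proof.
elim: s => [//|m s IH] _; rewrite big_cons.
have [->|s0] := eqVneq s [::].
  by rewrite big_nil maxn0; exists m; rewrite ?mem_head.
have [m' m's ->] := IH s0.
have [mm|mm] := leqP (absz m) (absz m').
  by exists m'; [rewrite inE m's orbT|].
by exists m; [rewrite mem_head|].
Qed.

Lemma spectrum_degree_mem L : L != fset0 -> (forall m : int, m \in L -> - m \in L) ->
  ((spectrum_degree L)%:Z \in L) /\ (- (spectrum_degree L)%:Z \in L).
Proof.
move=> L0 Lsym.
suff DL : (spectrum_degree L)%:Z \in L by split => //; exact: Lsym.
have /fset0Pn[m0 m0L] := L0.
have L0' : enum_fset L != [::] by rewrite -size_eq0 -/(#|` L|) cardfs_eq0.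
have [m mL mE] := bigmax_absz_mem L0'.
rewrite /spectrum_degree mE.
have [m_ge0|m_lt0] := leP 0 m; first by rewrite gez0_abs.
by rewrite ltz0_abs// Lsym.
Qed.

Lemma coef_cleared_laurent L a i : (cleared_laurent L a)`_i =
  \sum_(m <- L) a m * (i == absz (m + (spectrum_degree L)%:Z))%:R.
Proof.
by rewrite /cleared_laurent coef_sum; apply: eq_bigr => m _; rewrite coefZ coefXn.
Qed.

(** The polynomial splits over the algebraically closed field [R[i]], and its nonzero constant term
    keeps 0 out of the list of roots; the multiplicities therefore add up to the degree. *)
Lemma sum_mup (p : {poly R[i]}) : p`_0 != 0 ->
  \sum_(z \in [set z : R[i] | z != 0]) ((mup z p)%:R : R) = (size p).-1%:R.
Proof.
move=> p00; have p0 : p != 0 by apply: contraNneq p00 => ->; rewrite coef0.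
have [r pE] := closed_field_poly_normal p.
have lc0 : lead_coef p != 0 by rewrite lead_coef_eq0.
have mupE z : mup z p = count_mem z r.
  rewrite pE -mul_polyC mupMr ?rootC//.
  elim: r {pE} => [|y r IH]; first by rewrite big_nil mupNroot// -polyC1 rootC oner_eq0.
  rewrite big_cons mupM ?polyXsubC_eq0//; last first.
    by rewrite monic_neq0// monic_prod_XsubC.
  by rewrite IH/= -[('X - _)]expr1 mup_XsubCX eq_sym; case: eqP.
have r0 : 0 \notin r.
  apply: contra p00 => r0; rewrite -horner_coef0 pE hornerZ horner_prod.
  by rewrite (big_rem _ r0)/= hornerXsubC subrr mul0r mulr0.
rewrite -(fsbig_widen [set` undup r]); last 2 first.
- by move=> z /=; rewrite mem_undup => zr; apply: contraNneq r0 => <-.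
- by move=> z /= [_]; rewrite mem_undup mupE => /negP/count_memPn->.
rewrite (fsbig_fwiden (undup r)); last 3 first.
- by [].
- exact: undup_uniq.
- by move=> z [].
rewrite -natr_sum; congr (_ %:R); under eq_bigr do rewrite mupE.
have -> : (size p).-1 = size r.
  by rewrite pE size_scale// size_prod_XsubC.
rewrite -[RHS]sum1_size -(big_undup_iterop_count _ r xpredT (fun=> 1%N)).
apply: eq_bigr => z _; rewrite Monoid.iteropE.
by elim: (count_mem z r) => //= n <-.
Qed.

(** The extreme coefficients of [a] sit at the indices [0] and [2 * D] of the cleared polynomial:
    one excludes the root 0, the other fixes the degree. *)
Lemma nb_rootsE L a : L != fset0 -> (forall m : int, m \in L -> - m \in L) ->
  a (spectrum_degree L)%:Z != 0 -> a (- (spectrum_degree L)%:Z) != 0 ->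
  nb_roots L a = (2 * spectrum_degree L)%:R.
Proof.
move=> L0 Lsym aD aND; have [DL NDL] := spectrum_degree_mem L0 Lsym.
set D := spectrum_degree L in aD aND DL NDL *.
have coefD (i : nat) (m0 : int) : m0 \in L ->
    (forall m, m \in L -> (i == absz (m + D%:Z)) = (m == m0)) ->
    (cleared_laurent L a)`_i = a m0.
  move=> m0L H; rewrite coef_cleared_laurent big_seq.
  under eq_bigr => m mL do rewrite H// mulrC.
  by rewrite -big_seq sum_delta.
have absm m : m \in L -> (absz m <= D)%N by exact: mem_spectrum_degree.
have c0 : (cleared_laurent L a)`_0 = a (- D%:Z).
  apply: coefD => // m /absm mD; apply/idP/idP; lia.
have c2D : (cleared_laurent L a)`_(2 * D) = a D%:Z.
  apply: coefD => // m /absm mD; apply/idP/idP; lia.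
rewrite /nb_roots sum_mup ?c0//; congr (_%:R).
have -> : size (cleared_laurent L a) = (2 * D).+1.
  apply/eqP; rewrite eqn_leq; apply/andP; split.
    apply/leq_sizeP => j jD; rewrite coef_cleared_laurent big_seq big1// => m /absm mD.
    by rewrite (_ : _ == _ = false) ?mulr0//; lia.
  by rewrite ltnNge; apply/negP => /leq_sizeP/(_ _ (leqnn _)); rewrite c2D; apply/eqP.
by [].
Qed.
End LaurentRoots.

(** * Asymptotics of the correlation *)

Section IntegralAlmostEverywhere.
Context (d : measure_display) (T : measurableType d) (R : realType).
Context (mu : {measure set T -> \bar R}).
Local Open Scope ereal_scope.

(* No measurability is assumed: the integral of a nonnegative function is
   defined as a supremum over the simple functions below it. *)
Lemma le_integral_nonneg (f g : T -> \bar R) : (forall x, 0 <= f x) ->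
  (forall x, f x <= g x) -> \int[mu]_x f x <= \int[mu]_x g x.
Proof.
move=> f0 fg; have g0 x : 0 <= g x by exact: le_trans (fg x).
rewrite !ge0_integralTE//; apply: le_ereal_sup => _ [h /= hf <-].
by exists h => //= x; exact: le_trans (hf x) (fg x).
Qed.

(** Here [f] is squeezed between two modifications of [g], equal to [0] and to [+oo] on [B]; these
    are measurable and have the integral of [g]. It is applied to numbers of roots, whose
    measurability is not established. *)
Lemma integral_eq_off_null (f g : T -> \bar R) (B : set T) :
  (forall x, 0 <= f x) -> (forall x, 0 <= g x) -> measurable_fun setT g ->
  measurable B -> mu B = 0 -> (forall x, ~ B x -> f x = g x) ->
  \int[mu]_x f x = \int[mu]_x g x.
Proof.
move=> f0 g0 mg mB B0 fg.
have nB : ae_eq mu setT (fun x => if x \in B then 0 else g x) g.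
  exists B; split => // x /= /not_implyP[_]; case: ifPn => [|_]; rewrite ?inE//.
have nB' : ae_eq mu setT (fun x => if x \in B then +oo else g x) g.
  exists B; split => // x /= /not_implyP[_]; case: ifPn => [|_]; rewrite ?inE//.
have mif (c : \bar R) : measurable_fun setT (fun x => if x \in B then c else g x).
  apply: measurable_fun_ifT => //; apply: (measurable_fun_bool true).
  by rewrite setTI preimage_mem_true.
apply/eqP; rewrite eq_le; apply/andP; split.
- rewrite -(ge0_ae_eq_integral measurableT (mif +oo) mg _ _ nB')//; last first.
    by move=> x _; case: ifP.
  apply: le_integral_nonneg => // x; case: ifPn => [_|]; first exact: leey.
  by rewrite notin_setE => /fg->.
- rewrite -(ge0_ae_eq_integral measurableT (mif 0) mg _ _ nB)//; last first.
    by move=> x _; case: ifP.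
  apply: le_integral_nonneg => // x; first by case: ifP.
  by case: ifPn => [//|]; rewrite notin_setE => /fg->.
Qed.
End IntegralAlmostEverywhere.

(** * The correlation of two values at a small distance *)

Section Correlation.
Context {R : realType} (L : {fset int}).
Context (L_neq0 : L != fset0).
Local Notation N := (#|` L|%:R : R).

Definition correlation (h : R) : R := N^-1 * \sum_(k <- L) cos (k%:~R * h).
Definition mean_square : R := N^-1 * \sum_(k <- L) k%:~R ^+ 2.
(** With cos th = [correlation h], this is sin (th / 2), by 1 - cos x = 2 sin^2 (x / 2) applied to
    each frequency. It behaves linearly in [h] near 0, whereas acos is singular at
    [correlation 0 = 1]. *)
Definition half_chord (h : R) : R :=
  Num.sqrt (N^-1 * \sum_(k <- L) sin (k%:~R * (h / 2)) ^+ 2).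

Lemma card_gt0 : 0 < N.
Proof. by rewrite ltr0n cardfs_gt0. Qed.

Lemma mean_const (c : R) : N^-1 * \sum_(k <- L) c = c.
Proof.
rewrite big_const_seq count_predT iter_addr_0 -[c *+ _]mulr_natl mulKf// gt_eqF//.
exact: card_gt0.
Qed.

Lemma mean_le (f g : int -> R) : (forall k, f k <= g k) ->
  N^-1 * \sum_(k <- L) f k <= N^-1 * \sum_(k <- L) g k.
Proof.
move=> fg; rewrite ler_wpM2l ?invr_ge0 ?(ltW card_gt0)//.
by apply: ler_sum => k _; exact: fg.
Qed.

Lemma mean_square_ge0 : 0 <= mean_square.
Proof.
rewrite mulr_ge0 ?invr_ge0 ?(ltW card_gt0)//.
by apply: sumr_ge0 => k _; exact: sqr_ge0.
Qed.

Lemma correlation0 : correlation 0 = 1.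
Proof.
rewrite -[RHS]mean_const /correlation; congr (_ * _); apply: eq_bigr => k _.
by rewrite mulr0 cos0.
Qed.

Lemma correlationN h : correlation (- h) = correlation h.
Proof. by congr (_ * _); apply: eq_bigr => k _; rewrite mulrN cosN. Qed.

Lemma half_chord_sqr h : half_chord h ^+ 2 =
  N^-1 * \sum_(k <- L) sin (k%:~R * (h / 2)) ^+ 2.
Proof.
rewrite sqr_sqrtr// mulr_ge0 ?invr_ge0 ?(ltW card_gt0)//.
by apply: sumr_ge0 => k _; exact: sqr_ge0.
Qed.

Lemma half_chord_ge0 h : 0 <= half_chord h.
Proof. exact: sqrtr_ge0. Qed.

Lemma correlation_half_chord h : correlation h = 1 - 2 * half_chord h ^+ 2.
Proof.
rewrite half_chord_sqr -{1}(mean_const 1) mulrCA -mulrBr /correlation; congr (_ * _).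
rewrite mulr_sumr -sumrB; apply: eq_bigr => k _.
rewrite (_ : k%:~R * h = (k%:~R * (h / 2)) *+ 2); last by rewrite mulr2n; field.
by rewrite cos_mulr2n cos2sin2; ring.
Qed.

Lemma half_chord_le1 h : half_chord h <= 1.
Proof.
rewrite -(ler_pXn2r (n := 2)) ?nnegrE ?half_chord_ge0// expr1n half_chord_sqr.
rewrite -[leRHS]mean_const; apply: mean_le => k.
by rewrite sin2cos2 gerBl sqr_ge0.
Qed.

Lemma correlation_itv h : -1 <= correlation h <= 1.
Proof.
rewrite correlation_half_chord; have := half_chord_le1 h; have := half_chord_ge0 h.
by move: (half_chord h) => s s0 s1; apply/andP; split; nra.
Qed.

Definition half_angle h : R := acos (correlation h) / 2.

Lemma half_angle_itv h : 0 <= half_angle h <= pi / 2.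
Proof.
have c := correlation_itv h; rewrite /half_angle divr_ge0 ?acos_ge0//=.
by rewrite ler_pM2r ?invr_gt0// acos_lepi.
Qed.

Lemma sin_half_angle h : sin (half_angle h) = half_chord h.
Proof.
have /andP[x0 x1] := half_angle_itv h.
have s0 : 0 <= sin (half_angle h).
  by apply: sin_ge0_pi; rewrite x0/= (le_trans x1)// ler_pdivrMr// ler_peMr ?pi_ge0// ler1n.
apply/eqP; rewrite -(eqrXn2 (n := 2))// ?half_chord_ge0//; apply/eqP.
have cE : cos (half_angle h *+ 2) = correlation h.
  by rewrite /half_angle mulr2n -splitr acosK// in_itv/= correlation_itv.
have : cos (half_angle h *+ 2) = 1 - 2 * sin (half_angle h) ^+ 2.
  by rewrite cos_mulr2n cos2sin2; ring.
by rewrite cE correlation_half_chord; lra.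
Qed.

Lemma half_angle_asin h : half_angle h = asin (half_chord h).
Proof.
have /andP[x0 x1] := half_angle_itv h; rewrite -sin_half_angle sinK// in_itv/= x1 andbT.
by rewrite (le_trans _ x0)// oppr_le0 divr_ge0// pi_ge0.
Qed.

Definition mesh (n : nat) : R := 2 * pi / n.+1%:R.

Lemma mesh_gt0 n : 0 < mesh n.
Proof. by rewrite divr_gt0// mulr_gt0// pi_gt0. Qed.

Lemma cvg_mesh : mesh n @[n --> \oo] --> (0 : R).
Proof.
rewrite -[X in _ --> X](mulr0 (2 * pi)); apply: cvgMl_tmp; exact: cvg_harmonic.
Qed.

Lemma cvg_sin_ratio (k : int) :
  sin (k%:~R * (mesh n / 2)) / mesh n @[n --> \oo] --> (k%:~R / 2 : R).
Proof.
apply/cvgrPdistC_le => /= eps eps0.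
(* The error is at most k^2 h / 2; the added 1 keeps the threshold for [h] defined when [k = 0]. *)
have C0 : 0 < k%:~R ^+ 2 + 1 :> R by rewrite ltr_wpDl// sqr_ge0.
have := cvg_mesh => /cvgr0_norm_le/(_ (eps / (k%:~R ^+ 2 + 1)) (divr_gt0 eps0 C0)).
apply: filterS => n; rewrite (gtr0_norm (mesh_gt0 n)) ler_pdivlMr// => H.
have h0 := mesh_gt0 n; set h := mesh n in h0 H *.
have [_] := cos_expansion 0 (k%:~R * (h / 2)).
rewrite sin0 cos0 !subr0 mul1r => S.
have -> : sin (k%:~R * (h / 2)) / h - k%:~R / 2 = (sin (k%:~R * (h / 2)) - k%:~R * (h / 2)) / h.
  by field; rewrite gt_eqF.
rewrite normrM normfV (gtr0_norm h0) ler_pdivrMr// (le_trans S)// exprMn.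
have k2 : 0 <= k%:~R ^+ 2 :> R by exact: sqr_ge0.
move: (k%:~R ^+ 2) k2 H => K K0 H.
have : h * K <= eps by nra.
by move=> H'; nra.
Qed.

Lemma cvg_half_chord_ratio :
  half_chord (mesh n) / mesh n @[n --> \oo] --> (Num.sqrt mean_square / 2 : R).
Proof.
rewrite (_ : (fun n => _) = (fun n => Num.sqrt (N^-1 * \sum_(k <- L)
   (sin (k%:~R * (mesh n / 2)) / mesh n) ^+ 2))); last first.
  apply/funext => n; have h0 := mesh_gt0 n.
  under eq_bigr do rewrite expr_div_n.
  rewrite -mulr_suml mulrA sqrtrM ?sqrtrV ?sqr_ge0 ?sqrtr_sqr ?(gtr0_norm h0)//.
  by rewrite -half_chord_sqr sqr_ge0.
rewrite (_ : Num.sqrt mean_square / 2 = Num.sqrt (N^-1 * \sum_(k <- L) (k%:~R / 2) ^+ 2)).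
  apply: cvg_comp; last exact: sqrt_continuous.
  apply: cvgMl_tmp.
  elim: (enum_fset L) => [|k s IH].
    by under eq_fun do rewrite big_nil; rewrite big_nil; exact: cvg_cst.
  under eq_fun do rewrite big_cons; rewrite big_cons; apply: cvgD => //.
  rewrite expr2; under eq_fun do rewrite expr2.
  by apply: cvgM; exact: cvg_sin_ratio.
under eq_bigr do rewrite expr_div_n.
rewrite -mulr_suml mulrA [RHS]sqrtrM ?mean_square_ge0//.
by rewrite sqrtrV// sqrtr_sqr ger0_norm.
Qed.

Lemma cvg_half_chord : half_chord (mesh n) @[n --> \oo] --> (0 : R).
Proof.
rewrite (_ : (fun n => _) = (fun n => half_chord (mesh n) / mesh n * mesh n)).
  rewrite -[X in _ --> X](mulr0 (Num.sqrt mean_square / 2)).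
  by apply: cvgM; [exact: cvg_half_chord_ratio|exact: cvg_mesh].
by apply/funext => n; rewrite divfK// gt_eqF// mesh_gt0.
Qed.

Lemma cvg_half_angle : half_angle (mesh n) @[n --> \oo] --> (0 : R).
Proof.
have a0 : asin (0 : R) = 0 by rewrite -[X in asin X](@sin0 R) sinK// in_itv/=
  oppr_le0 divr_ge0// pi_ge0.
have H : asin (half_chord (mesh n)) @[n --> \oo] --> (asin 0 : R).
  apply: (cvg_comp _ _ cvg_half_chord).
  by apply: continuous_asin; rewrite ltrN10 ltr01.
by rewrite a0 in H; under eq_fun do rewrite half_angle_asin.
Qed.

(** Let x be the half angle and s its sine. From x <= s + 2 x^2 and x <= 1/4 follows x <= 2 s, and
    then x <= s (1 + 8 s). So x / h is squeezed between s / h and a multiple of it with factor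
    tending to 1. *)
Lemma cvg_half_angle_ratio :
  half_angle (mesh n) / mesh n @[n --> \oo] --> (Num.sqrt mean_square / 2 : R).
Proof.
have up : half_chord (mesh n) / mesh n * (1 + 8 * half_chord (mesh n)) @[n --> \oo]
    --> (Num.sqrt mean_square / 2 : R).
  rewrite -[X in _ --> X]mulr1; apply: cvgM; first exact: cvg_half_chord_ratio.
  rewrite -[X in _ --> X]addr0 -[X in _ --> _ + X](mulr0 8); apply: cvgD; first exact: cvg_cst.
  by apply: cvgMl_tmp; exact: cvg_half_chord.
apply: (squeeze_cvgr _ cvg_half_chord_ratio up).
have q0 : 0 < 4^-1 :> R by rewrite invr_gt0.
have := cvg_half_angle => /cvgr0_norm_le/(_ _ q0); apply: filterS => n.
have /andP[x0 _] := half_angle_itv (mesh n); rewrite (ger0_norm x0) => x4.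
have h0 := mesh_gt0 n.
rewrite [X in _ <= _ <= X]mulrAC !ler_pM2r ?invr_gt0// -sin_half_angle.
have [_] := cos_expansion 0 (half_angle (mesh n)).
rewrite sin0 cos0 !subr0 mul1r ler_norml.
have sx : sin (half_angle (mesh n)) <= half_angle (mesh n).
  rewrite (le_trans (ler_norm _))// (le_trans (normr_sin_le _))//.
  by rewrite ger0_norm.
move: (half_angle (mesh n)) (sin _) x0 x4 sx => x s x0 x4 sx /andP[S1 S2].
have x2 : x <= 2 * s by nra.
by apply/andP; split=> //; nra.
Qed.

(** With n + 1 = 2 pi / h and an angle 2 x, the product is 4 x / h, and x / h tends to half the root
    of the mean square. *)
Lemma cvg_expected_sign_changes :
  n.+1%:R * (acos (correlation (mesh n)) / pi) @[n --> \oo] --> (2 * Num.sqrt mean_square : R).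
Proof.
rewrite (_ : (fun n => _) = (fun n => 4 * (half_angle (mesh n) / mesh n))).
  rewrite (_ : 2 * _ = 4 * (Num.sqrt mean_square / 2)); last by field.
  by apply: cvgMl_tmp; exact: cvg_half_angle_ratio.
apply/funext => n; have h0 : mesh n != 0 by rewrite gt_eqF ?mesh_gt0.
have p0 : pi != 0 :> R by rewrite gt_eqF ?pi_gt0.
have -> : n.+1%:R = 2 * pi / mesh n.
  by rewrite /mesh invf_div mulrCA mulfV ?mulr1// mulf_neq0// pnatr_eq0.
rewrite /half_angle; set c := acos _; set h := mesh n in h0 *.
rewrite [LHS](_ : _ = (pi / pi) * (2 * c / h)); last by ring.
by rewrite divff// mul1r; field.
Qed.

End Correlation.

(** * Gaussian trigonometric polynomials *)

Lemma dotp_sqr_dim1 (R : realType) n (u v : 'I_n -> R) : (n <= 1)%N ->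
  dotp u v ^+ 2 = dotp u u * dotp v v.
Proof.
case: n u v => [|[|//]] u v _; first by rewrite /dotp !big_ord0 expr0n mul0r.
by rewrite /dotp !big_ord1; ring.
Qed.

Section RandomTrigonometricPolynomial.
Context {R : realType} (L : {fset int}).
Context (d : measure_display) (T : measurableType d) (P : probability T R).
Context (n : nat) (e : 'I_n -> R -> R) (xi : 'I_n -> T -> R) (F : T -> R -> R).
Context (L_neq0 : L != fset0).
Context (L_sym : forall m : int, m \in L -> - m \in L).
Context (e_basis : trig_orthonormal_basis L e).
Context (xi_gauss : gauss_family P xi).
Context (FE : forall w t, F w t = \sum_(i < n) xi i w * e i t).

Local Notation gamma := (@normal_prob R 0 1).
Local Notation ev t := (fun i => e i t).
Local Notation rho := (@correlation R L).

(** The standard deviation of [F] at every point: the reproducing kernel equals #L / (2 pi) on the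
    diagonal. *)
Definition variance_root : R := Num.sqrt (#|` L|%:R / (2 * pi)).
Local Notation r := variance_root.

Lemma variance_root_gt0 : 0 < r.
Proof.
by rewrite sqrtr_gt0 divr_gt0 ?mulr_gt0 ?pi_gt0// (card_gt0 L_neq0).
Qed.

Lemma F_lin w t : F w t = lin xi (ev t) w.
Proof. by rewrite FE; apply: eq_bigr => i _; rewrite mulrC. Qed.

Lemma dotp_ev s t : dotp (ev s) (ev t) = r ^+ 2 * rho (s - t).
Proof.
rewrite sqr_sqrtr; last by rewrite divr_ge0// mulr_ge0// pi_ge0.
rewrite /dotp (orthonormal_kernel s t L_sym e_basis) /dirichlet_kernel /correlation.
rewrite mulrA; congr (_ * _); rewrite mulrAC divff ?mul1r//.
by rewrite gt_eqF// (card_gt0 L_neq0).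
Qed.

Lemma measurable_lin u : measurable_fun setT (lin xi u).
Proof.
apply: measurable_sum => i; apply: measurable_funM => //; exact: (proj1 xi_gauss).
Qed.

Lemma measurable_F t : measurable_fun setT (fun w => F w t).
Proof. by under eq_fun do rewrite F_lin; exact: measurable_lin. Qed.

Lemma measurable_lin0 u : measurable [set w | lin xi u w = 0].
Proof.
rewrite (_ : mkset _ = lin xi u @^-1` [set 0])// -[X in measurable X]setTI.
exact: measurable_lin.
Qed.

Lemma lin_eq0_null u : dotp u u != 0 -> P [set w | lin xi u w = 0] = 0%E.
Proof.
move=> /(lin_standard_normal xi_gauss)[a [X [a0 mX PX uX]]].
rewrite -(normal_prob_set1 0) -PX//; congr (P _).
apply/seteqP; split => w /=; rewrite uX.
- by move/eqP; rewrite mulf_eq0 (negbTE a0) => /eqP.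
- by move=> ->; rewrite mulr0.
Qed.

Lemma F_eq0_null t : P [set w | F w t = 0] = 0%E.
Proof.
rewrite (_ : mkset _ = [set w | lin xi (ev t) w = 0]).
  apply: lin_eq0_null; rewrite dotp_ev subrr (correlation0 L_neq0) mulr1.
  by rewrite sqrf_eq0 gt_eqF// variance_root_gt0.
by apply/seteqP; split => w /=; rewrite F_lin.
Qed.

Lemma continuous_F w : continuous (F w).
Proof.
have [eT _ _] := e_basis.
rewrite (_ : F w = fun t => \sum_(i < n) xi i w * e i t); last exact/funext/FE.
apply: continuous_sum_fun => i; apply: continuous_scale_fun.
exact: continuous_trig (eT i).
Qed.

(* In dimension at most one the correlation would be identically 1 or -1. *)
Lemma dimension_gt1 (k : int) : k \in L -> k != 0 -> (1 < n)%N.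
Proof.
move=> kL k0; rewrite ltnNge; apply/negP => n1.
have p0 := pi_gt0 R; have N0 : 0 < #|` L|%:R :> R := card_gt0 L_neq0.
(* At this distance the term of frequency [k] vanishes, so the mean of the [#L] cosines is at most 1
   - 1 / #L in absolute value. *)
pose h : R := pi / 2 / k%:~R.
have kR : k%:~R != 0 :> R by rewrite intr_eq0.
have := dotp_sqr_dim1 (ev h) (ev 0) n1; rewrite !dotp_ev !subrr subr0 (correlation0 L_neq0) mulr1.
rewrite exprMn -expr2 => rhoE.
have r4 : (r ^+ 2) ^+ 2 != 0 by rewrite !sqrf_eq0 gt_eqF// variance_root_gt0.
have rho2 : rho h ^+ 2 = 1 by apply: (mulfI r4); rewrite rhoE mulr1.
have : `|rho h| < 1.
  rewrite /correlation normrM gtr0_norm ?invr_gt0// mulrC ltr_pdivrMr// mul1r.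
  rewrite (bigD1_seq k kL (fset_uniq L))/= {1}/h [k%:~R * _]mulrC divfK// cos_pihalf add0r.
  rewrite (le_lt_trans (ler_norm_sum _ _ _))//.
  apply: (@le_lt_trans _ _ (\sum_(i <- L | i != k) 1)).
    by apply: ler_sum => i _; exact: cos_max.
  have -> : #|` L|%:R = \sum_(i <- L) 1 :> R.
    by rewrite big_const_seq count_predT iter_addr_0.
  by rewrite [ltRHS](bigD1_seq k kL (fset_uniq L))/= ltrDr.
have := normr_ge0 (rho h); have := real_normK (num_real (rho h)); rewrite rho2.
by move: `|rho h| => c c2 c0 c1; nra.
Qed.

Lemma F_pair s t : (1 < n)%N -> exists a b (X Y : T -> R),
  [/\ a ^+ 2 = r ^+ 2, rho (s - t) ^+ 2 + b ^+ 2 = 1, gauss_pair P X Y,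
    forall w, F w s = a * X w & forall w, F w t = a * (rho (s - t) * X w + b * Y w)].
Proof.
move=> n1.
have [||| a [b [X [Y [ar rb XY us vt]]]]] := lin_gauss_pair (u := ev s) (v := ev t)
  n1 xi_gauss variance_root_gt0 (c := rho (s - t)).
- by rewrite dotp_ev subrr (correlation0 L_neq0) mulr1.
- by rewrite dotp_ev subrr (correlation0 L_neq0) mulr1.
- by rewrite dotp_ev.
by exists a, b, X, Y; split => // w; rewrite F_lin.
Qed.

Definition sign_change_event (s t : R) : set T := [set w | F w s * F w t < 0].

Lemma F_sign_change_prob s t : (1 < n)%N ->
  P (sign_change_event s t) = (acos (rho (s - t)) / pi)%:E.
Proof.
move=> /(F_pair s t)[a [b [X [Y [ar rb XY Fs Ft]]]]].
rewrite -(gauss_pair_sign_change XY rb); congr (P _).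
have r2 : 0 < r ^+ 2 by rewrite exprn_gt0// variance_root_gt0.
have FF w : F w s * F w t = r ^+ 2 * (X w * (rho (s - t) * X w + b * Y w)).
  by rewrite Fs Ft -ar; ring.
by apply/seteqP; split => w /=; rewrite /sign_change_event/= FF (pmulr_rlt0 _ r2).
Qed.

Lemma measurable_sign_change s t : measurable (sign_change_event s t).
Proof.
rewrite (_ : sign_change_event s t = (fun w => F w s * F w t) @^-1` `]-oo, 0[%classic).
  rewrite -[X in measurable X]setTI.
  by apply: measurable_funM => //; exact: measurable_F.
by apply/seteqP; split => w /=; rewrite /sign_change_event/= in_itv.
Qed.

Lemma rho_grid m j : rho (grid m j - grid m j.+1) = rho (mesh m).
Proof. by rewrite gridS opprD addNKr correlationN. Qed.

Lemma sign_changes_sum w m : (sign_changes (F w) m)%:R%:E =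
  (\sum_(j < m.+1) (\1_(sign_change_event (grid m j) (grid m j.+1)) w)%:E : \bar R)%E.
Proof.
rewrite sumEFin; congr EFin; rewrite /sign_changes -sum1_card big_mkcond natr_sum.
apply: eq_bigr => j _; rewrite indicE inE/=.
by case: ifPn => [H|/negP H]; [rewrite mem_set|rewrite memNset].
Qed.

Lemma measurable_sign_changes m :
  measurable_fun setT (fun w => (sign_changes (F w) m)%:R%:E : \bar R).
Proof.
under eq_fun do rewrite sign_changes_sum.
apply: emeasurable_sum => j; apply/measurable_EFinP; apply: measurable_indic.
exact: measurable_sign_change.
Qed.

Lemma expected_sign_changes m : (1 < n)%N ->
  (\int[P]_w (sign_changes (F w) m)%:R%:E =
    (m.+1%:R * (acos (rho (mesh m)) / pi))%:E)%E.
Proof.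
move=> n1; under eq_integral do rewrite sign_changes_sum.
rewrite ge0_integral_sum//=; last first.
  by move=> j; apply/measurable_EFinP; apply: measurable_indic;
    exact: measurable_sign_change.
rewrite (eq_bigr (fun=> (acos (rho (mesh m)) / pi)%:E)); last first.
  move=> j _; rewrite integral_indic//; last exact: measurable_sign_change.
  by rewrite setIT; apply: etrans (F_sign_change_prob _ _ n1) _; rewrite rho_grid.
by rewrite sumEFin sumr_const card_ord mulr_natl.
Qed.

(** * Double zeros have probability 0 *)

Definition small_pair (M : R) (m j : nat) : set T :=
  [set w | `|F w (grid m j)| <= M * mesh m ^+ 2 /\
     `|F w (grid m j.+1)| <= M * mesh m ^+ 2].

Lemma measurable_small_pair M m j : measurable (small_pair M m j).
Proof.
have mball t : measurable [set w | `|F w t| <= M * mesh m ^+ 2].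
  rewrite (_ : mkset _ = (fun w => F w t) @^-1`
    `[- (M * mesh m ^+ 2), M * mesh m ^+ 2]%classic).
    by rewrite -[X in measurable X]setTI; exact: measurable_F.
  by apply/seteqP; split => w/=; rewrite in_itv/= ler_norml.
exact: (measurableI _ _ (mball _) (mball _)).
Qed.

(** Normalising the values by [r] gives the small ball estimate with radius M h^2 / r. Its
    denominator satisfies b^2 = 1 - (1 - 2 s^2)^2 = 4 s^2 (1 - s^2), which is at least s^2 when s^2
    <= 1/2. *)
Lemma small_pair_prob M m j (s := half_chord L (mesh m) : R) :
  (1 < n)%N -> 0 <= M -> 0 < s -> s ^+ 2 <= 2^-1 ->
  (P (small_pair M m j) <= (8 * (M * mesh m ^+ 2 / r) ^+ 2 / s)%:E)%E.
Proof.
move=> n1 M0 s0 s2; have r0 := variance_root_gt0.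
have [a [b [X [Y [ar rb XY Fs Ft]]]]] := F_pair (grid m j) (grid m j.+1) n1.
rewrite rho_grid in rb Ft.
have e0 : 0 <= M * mesh m ^+ 2 / r.
  apply: divr_ge0; last exact: ltW.
  by apply: mulr_ge0 => //; exact: sqr_ge0.
have b2 : b ^+ 2 = 4 * s ^+ 2 * (1 - s ^+ 2).
  by move: rb; rewrite correlation_half_chord// -/s => rb; lra.
have bs : s <= `|b|.
  rewrite -ler_sqr ?nnegrE ?(ltW s0)// real_normK ?num_real// b2.
  by have := sqr_ge0 s; nra.
have b0 : b != 0 by rewrite -normr_gt0 (lt_le_trans s0).
have an : `|a| = r.
  by apply/eqP; rewrite -(eqrXn2 (n := 2)) ?(ltW r0)// real_normK ?num_real// ar.
apply: le_trans (_ : _ <= (8 * (M * mesh m ^+ 2 / r) ^+ 2 / `|b|)%:E)%E _; last first.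
  rewrite lee_fin; apply: ler_wpM2l; first by apply: mulr_ge0 => //; exact: sqr_ge0.
  by rewrite lef_pV2 ?posrE ?normr_gt0.
rewrite (le_trans _ (gauss_pair_small_ball XY rb b0 e0))//.
rewrite le_eqVlt; apply/orP; left; apply/eqP; congr (P _).
apply/seteqP; split => w /=; rewrite /small_pair/= Fs Ft !normrM an !(mulrC r) !ler_pdivlMr//.
Qed.

Lemma small_pairs_null M : (1 < n)%N -> 0 < mean_square L :> R -> 0 <= M ->
  P (\bigcap_m \bigcup_(j in `I_m.+1) small_pair M m j) = 0%E.
Proof.
move=> n1 ms0 M0.
pose W m := \big[setU/set0]_(j < m.+1) small_pair M m j.
rewrite (_ : \bigcap_m _ = \bigcap_m W m); last first.
  by apply: eq_bigcapr => m _; rewrite /W -bigcup_mkord.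
have mW m : measurable (W m).
  by apply: bigsetU_measurable => j _; exact: measurable_small_pair.
have r0 := variance_root_gt0.
pose q : R := Num.sqrt (mean_square L) / 2.
have q0 : 0 < q by rewrite divr_gt0// sqrtr_gt0.
(* As [q] is the limit of [half_chord / mesh], eventually s >= q h / 2. Then 2 pi / h cells of
   probability at most 8 (M h^2 / r)^2 / (q h / 2) add up to C h^2. *)
pose C : R := 8 * (M / r) ^+ 2 * (2 * pi) * (2 / q).
have bound : \forall m \near \oo, (P (W m) <= (C * mesh m ^+ 2)%:E)%E.
  have c1 := @cvg_half_chord_ratio R L L_neq0.
  have c2 := @cvg_half_chord R L L_neq0.
  near=> m.
  have h0 := @mesh_gt0 R m.
  have s1 : q / 2 * mesh m <= half_chord L (mesh m).
    rewrite -ler_pdivlMr// ltW//; near: m; apply: (cvgr_gt _ c1).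
    by rewrite -/q ltr_pdivrMr// ltr_pMr// ltr1n.
  have qh : 0 < q / 2 * mesh m by rewrite mulr_gt0// divr_gt0.
  have s0 : 0 < half_chord L (mesh m) :> R by exact: lt_le_trans s1.
  have s2 : half_chord L (mesh m) ^+ 2 <= 2^-1 :> R.
    have : half_chord L (mesh m) <= 2^-1 :> R.
      by near: m; apply: (cvgr_le _ c2); rewrite invr_gt0.
    by move=> sh; have := half_chord_ge0 L (mesh m : R); nra.
  have PW : (P (W m) <= \sum_(j < m.+1) P (small_pair M m j))%E.
    by apply: (@Boole_inequality _ _ _ P (small_pair M m)) => j _; exact: measurable_small_pair.
  apply: le_trans PW _.
  apply: (@le_trans _ _ (\sum_(j < m.+1) (8 * (M * mesh m ^+ 2 / r) ^+ 2 /
      half_chord L (mesh m))%:E)%E).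
    by apply: lee_sum => j _; exact: small_pair_prob.
  rewrite sumEFin sumr_const card_ord lee_fin -[leLHS]mulr_natl.
  have mE : m.+1%:R = 2 * pi / mesh m :> R.
    by rewrite /mesh invf_div mulrCA mulfV ?mulr1// mulf_neq0 ?pnatr_eq0// gt_eqF ?pi_gt0.
  rewrite mE.
  have -> : C * mesh m ^+ 2 =
      2 * pi / mesh m * (8 * (M * mesh m ^+ 2 / r) ^+ 2 / (q / 2 * mesh m)).
    by rewrite /C; field; rewrite !gt_eqF.
  apply: ler_wpM2l; first by rewrite -mE ler0n.
  apply: ler_wpM2l; first by rewrite mulr_ge0// sqr_ge0.
  by rewrite lef_pV2 ?posrE.
apply/eqP; rewrite eq_le measure_ge0 andbT.
apply/lee_addgt0Pr => eps eps0; rewrite add0e.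
have cC : C * mesh m ^+ 2 @[m --> \oo] --> (0 : R).
  rewrite -[X in _ --> X](mulr0 C); apply: cvgMl_tmp.
  rewrite -[X in _ --> X](mulr0 0).
  under eq_fun do rewrite expr2.
  by apply: cvgM; exact: cvg_mesh.
have : \forall m \near \oo, (P (\bigcap_m W m) <= eps%:E)%E.
  near=> m.
  apply: (@le_trans _ _ (P (W m))).
    apply: le_measure; rewrite ?inE//; first exact: bigcapT_measurable.
    exact: bigcap_inf.
  apply: (@le_trans _ _ (C * mesh m ^+ 2)%:E); first by near: m.
  by rewrite lee_fin; near: m; apply: (cvgr_le _ cC).
by move=> [m0 _ /(_ m0 (leqnn m0))].
Unshelve. all: by end_near.
Qed.

Lemma F_expansion : exists (df : T -> R -> R) (M : T -> R),
  forall w, expansion (F w) (df w) (M w).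
Proof.
have [eT _ _] := e_basis.
have [g gP] := choice (fun i => trig_has_expansion (eT i)).
have [M MP] := choice gP.
exists (fun w t => \sum_(i < n) xi i w * g i t), (fun w => \sum_(i < n) `|xi i w| * M i) => w.
rewrite (_ : F w = fun t => \sum_(i < n) xi i w * e i t); last exact/funext/FE.
by apply: expansion_sum => i; have [] := MP i.
Qed.

Definition liminf_sign_changes (w : T) : \bar R :=
  limn_einf (fun m => (sign_changes (F w) m)%:R%:E).

Lemma liminf_sign_changes_le w :
  (liminf_sign_changes w <= counting (circle_zeros (F w)))%E.
Proof.
rewrite /liminf_sign_changes limn_einf_lim; apply: lime_le; first exact: is_cvg_einfs.
apply: nearW => m; apply: le_trans (sign_changes_le m (@continuous_F w)).
by apply: ereal_inf_lbound; exists m => //=.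
Qed.

Lemma liminf_sign_changes_ge0 w : (0 <= liminf_sign_changes w)%E.
Proof.
rewrite /liminf_sign_changes limn_einf_lim; apply: lime_ge; first exact: is_cvg_einfs.
by apply: nearW => m; apply: le_ereal_inf_tmp => _ [k _ <-]; rewrite lee_fin.
Qed.

Lemma measurable_liminf_sign_changes : measurable_fun setT liminf_sign_changes.
Proof.
apply: (emeasurable_fun_cvg
  (fun k w => einfs (fun m => (sign_changes (F w) m)%:R%:E) k)).
  by apply: measurable_fun_einfs => m; exact: measurable_sign_changes.
move=> w _; rewrite /liminf_sign_changes limn_einf_lim; exact: is_cvg_einfs.
Qed.

Lemma measure_bigcup0 (A : (set T)^nat) : (forall k, measurable (A k)) ->
  (forall k, P (A k) = 0%E) -> P (\bigcup_k A k) = 0%E.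
Proof.
move=> mA A0; apply: measure_negligible; first exact: bigcupT_measurable.
by apply: negligible_bigcup => k; apply/(negligibleP P (mA k)); exact: A0.
Qed.

(** The exceptional samples are covered by events that depend on countably many grid values and are
    therefore measurable; the event of a double zero itself is never measured. *)
Lemma zeros_sign_changes_ae : (1 < n)%N -> 0 < mean_square L :> R ->
  exists B, [/\ measurable B, P B = 0%E &
    forall w, ~ B w -> counting (circle_zeros (F w)) = liminf_sign_changes w].
Proof.
move=> n1 ms0.
(* The remainder constant of the expansion depends on the sample; integer values of [M] dominate it
   while keeping the union countable. *)
pose U (M : nat) := \bigcap_m \bigcup_(j in `I_m.+1) small_pair M%:R m j.
pose V (m : nat) := \bigcup_j [set w | F w (grid m j) = 0].
have mF0 t : measurable [set w | F w t = 0].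
  rewrite (_ : mkset _ = (fun w => F w t) @^-1` [set 0])//.
  by rewrite -[X in measurable X]setTI; exact: measurable_F.
have mU M : measurable (U M).
  apply: bigcapT_measurable => m; apply: bigcup_measurable => j _.
  exact: measurable_small_pair.
have mV m : measurable (V m) by exact: bigcupT_measurable.
have V0 m : P (V m) = 0%E.
  by apply: measure_bigcup0 => // j; exact: F_eq0_null.
have mUU : measurable (\bigcup_M U M) by exact: bigcupT_measurable.
have mVV : measurable (\bigcup_m V m) by exact: bigcupT_measurable.
exists (\bigcup_M U M `|` \bigcup_m V m); split; first exact: measurableU.
  rewrite measureU0//; apply: measure_bigcup0 => // M.
  exact: small_pairs_null.
move=> w /not_orP[wU wV]; apply/eqP; rewrite eq_le liminf_sign_changes_le andbT.
have [df [M fM]] := F_expansion.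
pose K := (Num.truncn (M w)).+1.
have K0 : (0 : R) < K%:R by rewrite ltr0n.
have fK : expansion (F w) (df w) K%:R.
  move=> x z; apply: le_trans (fM w x z) _; rewrite ler_wpM2r ?sqr_ge0// ltW//.
  exact: Num.Theory.truncnS_gt.
apply: (circle_zeros_le K0 fK).
- move=> t t2 ft; apply/eqP => dt; apply: wU; exists K => // m _.
  have [j [j1 j2]] := double_zero_grid m (ltW K0) fK t2 ft dt.
  by exists j => //=; exact: ltn_ord.
- move=> m j _; apply/eqP => Fj; apply: wV; exists m => //; by exists j.
Qed.

Lemma integral_liminf_sign_changes : (1 < n)%N -> 0 < mean_square L :> R ->
  (\int[P]_w liminf_sign_changes w = (2 * Num.sqrt (mean_square L))%:E)%E.
Proof.
move=> n1 ms0; have [B [mB B0 BE]] := zeros_sign_changes_ae n1 ms0.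
have cE : (\int[P]_w (sign_changes (F w) m)%:R%:E)%E @[m --> \oo] -->
    (2 * Num.sqrt (mean_square L : R))%:E.
  under eq_fun do rewrite expected_sign_changes//.
  by apply: cvg_EFin; [exact: nearW|exact: cvg_expected_sign_changes].
apply/eqP; rewrite eq_le; apply/andP; split.
- rewrite -(cvg_limn_einf_sup cE).1.
  apply: fatou => //; first by move=> m; exact: measurable_sign_changes.
- rewrite -(cvg_lim _ cE)//; apply: lime_le; first by apply/cvg_ex; eexists; exact: cE.
  apply: nearW => m.
  (* For a given grid the sign changes are bounded by the number of zeros, not visibly by the
     liminf; the liminf is therefore exchanged for the number of zeros, which equals it off [B]. *)
  rewrite -(integral_eq_off_null (f := fun w => counting (circle_zeros (F w))) _ _
    measurable_liminf_sign_changes mB B0 BE).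
  + apply: le_integral_nonneg => w; first by rewrite lee_fin.
    exact: sign_changes_le (@continuous_F w).
  + by move=> w; exact: le_trans (liminf_sign_changes_ge0 w) (liminf_sign_changes_le w).
  + exact: liminf_sign_changes_ge0.
Qed.

End RandomTrigonometricPolynomial.

(** * From trigonometric to Laurent polynomials *)

Lemma trig_cos {R : realType} (L : {fset int}) (k : int) : k \in L ->
  Trig L (fun t : R => cos (k%:~R * t)).
Proof.
move=> kL; exists (fun j => (j == k)%:R), (fun=> 0) => t.
under eq_bigr do rewrite mul0r addr0.
by rewrite (sum_delta (fun j => cos (j%:~R * t))).
Qed.

Lemma circle_integral_cos_sqr {R : realType} (k : int) :
  circle_integral (fun t : R => cos (k%:~R * t) * cos (k%:~R * t)) != 0.
Proof.
have -> : circle_integral (fun t : R => cos (k%:~R * t) * cos (k%:~R * t)) =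
    circle_integral (fun t : R => cos (k%:~R * t + 0) * cos (k%:~R * t + 0)).
  by congr circle_integral; apply/funext => t; rewrite addr0.
rewrite circle_integral_cos2 eqxx addr0 subrr cos0 !mulr1 gt_eqF// mulr_gt0 ?pi_gt0//.
by rewrite ltr_wpDl.
Qed.

Lemma nb_roots_ge0 {R : realType} (L : {fset int}) (a : int -> R[i]) : 0 <= nb_roots L a.
Proof. by rewrite /nb_roots; elim/big_ind: _ => // x y; exact: addr_ge0. Qed.

Lemma circle_restriction_set0 {R : realType} (a : int -> R[i]) t :
  circle_restriction [fset 0]%fset a t = circle_restriction [fset 0]%fset a 0.
Proof.
rewrite /circle_restriction [LHS]Re_laurent [RHS]Re_laurent.
apply: eq_big_seq => m; rewrite in_fset1 => /eqP->.
have z0 (s : R) : 0%:~R * s = 0 by rewrite mulr0z mul0r.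
by rewrite (z0 t) (z0 0).
Qed.

Section RandomLaurentPolynomial.
Context {R : realType} (L : {fset int}).
Context (d : measure_display) (T : measurableType d) (P : probability T R).
Context (a : T -> int -> R[i]).
Context (L_neq0 : L != fset0).
Context (L_sym : forall m : int, m \in L -> - m \in L).
Context (n : nat) (e : 'I_n -> R -> R) (xi : 'I_n -> T -> R).
Context (a_real : forall w, real_laurent L (a w)).
Context (e_basis : trig_orthonormal_basis L e).
Context (xi_gauss : gauss_family P xi).
Context (aE : forall w t,
  circle_restriction L (a w) t = \sum_(i < n) xi i w * e i t).

Lemma nb_real_rootsE w :
  nb_real_roots L (a w) = counting (circle_zeros (circle_restriction L (a w))).
Proof. by rewrite /nb_real_roots real_rootsE. Qed.

Lemma nb_real_roots_ge0 w : (0 <= nb_real_roots L (a w))%E.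
Proof. by rewrite /nb_real_roots /counting; case: asboolP; rewrite ?lee_fin// leey. Qed.

Lemma lin_circle_integral (g : R -> R) w : continuous g ->
  lin xi (fun i => circle_integral (fun t => e i t * g t)) w =
  circle_integral (fun t => circle_restriction L (a w) t * g t).
Proof.
move=> cg; have [eT _ _] := e_basis.
have ce i : continuous (fun t => e i t * g t).
  by apply: continuous_mul_fun => //; exact: continuous_trig (eT i).
transitivity (circle_integral (fun t => \sum_(i < n) xi i w * (e i t * g t))).
  rewrite circle_integral_sum; last by move=> i; exact: continuous_scale_fun.
  by apply: eq_bigr => i _; rewrite circle_integralZ// mulrC.
by congr circle_integral; apply/funext => t; rewrite aE mulr_suml; apply: eq_bigr => i _; ring.
Qed.

(** Up to the factor 2 pi, [Re (a D)] is the Gaussian linear form obtained by pairing with cos (D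
    t). The squared length of its coefficient vector is the squared norm of this function
    (Parseval), hence nonzero. Since [Re (a (- D))] has the same value, one null set settles both
    extreme coefficients. *)
Lemma nb_roots_ae : exists B, [/\ measurable B, P B = 0%E &
  forall w, ~ B w -> nb_roots L (a w) = (2 * spectrum_degree L)%:R].
Proof.
have [DL NDL] := spectrum_degree_mem L_neq0 L_sym.
set D : int := (spectrum_degree L)%:Z in DL NDL.
pose g (t : R) := cos (D%:~R * t).
have cg : continuous g by exact: continuous_trig (trig_cos DL).
pose u i := circle_integral (fun t => e i t * g t).
have [_ _ eS] := e_basis; have [c cE] := eS _ (trig_cos DL : Trig L g).
have uc i : u i = c i by rewrite (orthonormal_coordinates e_basis cE).
have uu : dotp u u != 0.
  have ce i : continuous (fun t => e i t * g t).
    have [eT _ _] := e_basis.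
    by apply: continuous_mul_fun => //; exact: continuous_trig (eT i).
  rewrite (_ : dotp u u = circle_integral (fun t => g t * g t)).
    exact: circle_integral_cos_sqr.
  transitivity (circle_integral (fun t => \sum_(i < n) c i * (e i t * g t))).
    rewrite circle_integral_sum; last by move=> i; exact: continuous_scale_fun.
    by apply: eq_bigr => i _; rewrite circle_integralZ// -/(u i) uc.
  congr circle_integral; apply/funext => t; rewrite {2}cE mulr_suml.
  by apply: eq_bigr => i _; ring.
exists [set w | lin xi u w = 0]; split.
- exact: (measurable_lin0 xi_gauss).
- exact: (lin_eq0_null xi_gauss uu).
move=> w /= uw.
have [ReE ReI] := fourier_cos_coefficient (a_real w) DL NDL.
have Re0 : complex.Re (a w D) != 0.
  apply: contra_notN uw => /eqP Re0.
  by rewrite lin_circle_integral// ReI Re0 mulr0.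
apply: nb_rootsE => //.
- by apply: contraNneq Re0 => ->.
- by rewrite ReE in Re0; apply: contraNneq Re0 => ->.
Qed.
End RandomLaurentPolynomial.

Local Open Scope fset_scope.
Local Open Scope ring_scope.

Theorem theorem2p1 (R : realType) (L : {fset int})
    (L_neq0 : L != fset0) (L_sym : forall m : int, m \in L -> - m \in L)
    (d : measure_display) (T : measurableType d) (P : probability T R)
    (a : T -> int -> R[i]) (a_random : random_real_laurent L P a) :
  expected_nb_real_roots L P a =
    (2 * Num.sqrt ((#|` L|)%:R^-1 * \sum_(m <- L) (m%:~R : R) ^+ 2))%:E
  /\
  (L != [fset 0] ->
   real_root_probability L P a =
     ((spectrum_degree L)%:R^-1 *
      Num.sqrt ((#|` L|)%:R^-1 * \sum_(m <- L) (m%:~R : R) ^+ 2))%:E).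
Proof.
have [a_real [n [e [xi [e_basis aE xiP]]]]] := a_random.
have xi_gauss : gauss_family P (fun i => xi i : T -> R).
  by split => [i|B mB]; [exact: measurable_funPT|exact: xiP].
have rE w := nb_real_rootsE a_real w.
(* For the spectrum {0} the polynomial is a constant, nonzero off a null set, and both sides of (a)
   are 0. The planar argument requires a nonzero frequency. *)
have [L0|L0] := eqVneq L [fset 0].
  split; last by [].
  rewrite L0 big_seq_fset1 mulr0z expr0n mulr0 sqrtr0 mulr0 /expected_nb_real_roots -L0.
  rewrite (integral_eq_off_null (g := cst 0%E) (B := [set w | circle_restriction L (a w) 0 = 0])).
  - by rewrite integral0.
  - exact: nb_real_roots_ge0.
  - by [].
  - exact: measurable_cst.
  - rewrite (_ : mkset _ = (fun w => circle_restriction L (a w) 0) @^-1` [set 0])//.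
    by rewrite -[X in measurable X]setTI; exact: (measurable_F xi_gauss aE).
  - exact: (F_eq0_null L_neq0 L_sym e_basis xi_gauss aE).
  move=> w /= w0; rewrite rE (_ : circle_zeros _ = set0) ?measure0//.
    by rewrite /counting asboolT// fset_set0.
  apply/seteqP; split => // z [t [_ +] _].
  by rewrite {1}L0 circle_restriction_set0 -L0.
have [k kL k0] : exists2 k : int, k \in L & k != 0.
  apply: contrapT => H; move/negP: L0; apply; apply/eqP/fsetP => k; rewrite inE.
  have L00 k' : k' \in L -> k' = 0.
    by move=> k'L; apply/eqP; apply: contrapT => /negP k'0; apply: H; exists k'.
  apply/idP/eqP => [/L00//|->].
  by have /fset0Pn[m mL] := L_neq0; rewrite -(L00 _ mL).
have n1 : (1 < n)%N by exact: (dimension_gt1 L_neq0 L_sym e_basis kL k0).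
have ms0 : 0 < mean_square L :> R.
  rewrite mulr_gt0 ?invr_gt0 ?(card_gt0 L_neq0)//.
  rewrite (bigD1_seq k kL (fset_uniq L))/= ltr_wpDr//.
    by apply: sumr_ge0 => j _; exact: sqr_ge0.
  by rewrite exprn_even_gt0//= intr_eq0.
have D0 : (0 < spectrum_degree L)%N.
  by apply: leq_trans (mem_spectrum_degree kL); rewrite absz_gt0.
have [B [mB B0 BE]] := zeros_sign_changes_ae L_neq0 L_sym e_basis xi_gauss aE n1 ms0.
have gI := integral_liminf_sign_changes L_neq0 L_sym e_basis xi_gauss aE n1 ms0.
set g := liminf_sign_changes _ in BE gI.
have mg : measurable_fun setT g by exact: (measurable_liminf_sign_changes xi_gauss aE).
have g0 w : (0 <= g w)%E by exact: liminf_sign_changes_ge0.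
split=> [|_].
  rewrite -[RHS]gI; apply: (integral_eq_off_null _ _ mg mB B0) => //.
    by move=> w; exact: nb_real_roots_ge0.
  by move=> w /BE; rewrite rE.
have [B' [mB' B'0 B'E]] := nb_roots_ae L_neq0 L_sym a_real e_basis xi_gauss aE.
pose c : R := (2 * spectrum_degree L)%:R^-1.
have D20 : (2 * spectrum_degree L)%:R != 0 :> R by rewrite pnatr_eq0 muln_eq0/= -lt0n.
have c0 : 0 <= c by rewrite invr_ge0.
transitivity (\int[P]_w (c%:E * g w))%E.
  (* On the exceptional set the root count may be 0 and the quotient takes its default value; there
     only its nonnegativity is used. *)
  apply: (integral_eq_off_null (B := B `|` B')).
  - move=> w; apply: mule_ge0; first exact: nb_real_roots_ge0.
    by rewrite inve_ge0 lee_fin nb_roots_ge0.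
  - by move=> w; apply: mule_ge0.
  - exact: measurable_funeM.
  - exact: measurableU.
  - by rewrite measureU0.
  move=> w /not_orP[/BE Bw /B'E B'w].
  by rewrite rE Bw B'w muleC inver (negbTE D20).
rewrite ge0_integralZl// gI -EFinM; congr EFin.
(* The 2 in the number [2 * spectrum_degree L] of roots cancels the 2 of (a). *)
rewrite /c natrM invfM mulrACA mulVf ?mul1r//.
Qed.
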